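(* The continued fraction \[ 36+\cfrac{324}{33-\cfrac{9\cdot3^4}{40\cdot2^2+2-\cfrac{9\cdot5^4}{40\cdot3^2+2-\cdots}}}, \] i.e. with $a(0)=36$, $a(1)=33$, $a(n)=40n^2+2$ for $n\ge2$, $b(0)=324$, $b(n)=-9(2n+1)^4$ for $n\ge1$, converges to $2^{-1/3}\big(\Gamma(1/3)/\Gamma(2/3)\big)^6$. Moreover, with $p(n)/q(n)$ its $n$-th convergent, as $n\to\infty$ \[ 2^{-1/3}\Big(\frac{\Gamma(1/3)}{\Gamma(2/3)}\Big)^6-\frac{p(n)}{q(n)}\sim\frac{4\cdot2^{-1/3}(\Gamma(1/3)/\Gamma(2/3))^6}{3^{2n+2}}. \]
   Context: For sequences $a(n),b(n)$, the continued fraction is $a(0)+\cfrac{b(0)}{a(1)+\cfrac{b(1)}{a(2)+\cdots}}$ and its $n$-th convergent $p(n)/q(n)$ is the truncation ending with $b(n-1)/a(n)$. *)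

(* Defs.v *)
From Stdlib Require Import Reals.
From Coquelicot Require Import Coquelicot.
Open Scope R_scope.

Definition Gamma (s : R) : R :=
  RInt_gen (fun t => Rpower t (s - 1) * exp (- t)) (at_right 0) (Rbar_locally p_infty).

Definition cf_a (n : nat) : R :=
  match n with
  | O => 36
  | S O => 33
  | _ => 40 * (INR n) ^ 2 + 2
  end.

Definition cf_b (n : nat) : R :=
  match n with
  | O => 324
  | _ => - 9 * (2 * INR n + 1) ^ 4
  end.

(* cf_pq n = (p(n-1), p(n), q(n-1), q(n)), with p(-1)=1, q(-1)=0, p(0)=a(0), q(0)=1,
   p(n) = a(n) p(n-1) + b(n-1) p(n-2), same for q. *)
Fixpoint cf_pq (n : nat) : R * R * R * R :=
  match n with
  | O => (1, cf_a 0, 0, 1)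
  | S m =>
      let '(pm, p, qm, q) := cf_pq m in
      (p, cf_a (S m) * p + cf_b m * pm, q, cf_a (S m) * q + cf_b m * qm)
  end.

Definition cf_p (n : nat) : R := let '(_, p, _, _) := cf_pq n in p.
Definition cf_q (n : nat) : R := let '(_, _, _, q) := cf_pq n in q.

(* Main.v *)
Require Import Defs.
From Stdlib Require Import Reals Lra Lia.
From Coquelicot Require Import Coquelicot.
Open Scope R_scope.

(** The recurrence of the convergents has the minimal solution ((2n+1)!!)^2 M_{n+1}, where
    M_m = ((1/2)_m / m!)^2 3F2(1/2, 1/2, 1/2; m+1, m+1; 1/4), so the continued fraction has
    value 36 M_0 / (M_0 - M_1).  Both M_0 and M_0 - M_1 are values, at c = 0 and (up to 3/4)
    at c = 1, of 3F2(1/2+2c, 1/2, 1/2; 1+c, 1+c; 1/4), a case of Bailey's cubic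
    transformation at an argument where it is summable: by creative telescoping, shifting c
    by 3 multiplies it by a rational function of c, and it tends to 1 as c grows.  This
    yields two infinite products; one for M_0 / (M_0 - M_1), which log-convexity of Gamma
    turns into the Gamma quotient, and one for M_0 (M_0 - M_1), which Stirling's
    asymptotics turn into a multiple of (lim m M_m)^2.  Finally 1/e_{n+1} - 1/e_n, with e_n
    the error of the n-th convergent, is explicit in terms of M by the Casoratian, and a
    Stolz argument gives the asymptotics of e_n. *)

(** * Cubic hypergeometric summation *)

(* Terms of 3F2(a, 1/2, 1/2; b, b; 1/4). *)
Fixpoint hyp_term (a b : R) (k : nat) : R :=
  match k with
  | O => 1
  | S j => hyp_term a b j *
      ((a + INR j) * (INR j + 1 / 2) ^ 2 / (4 * (INR j + 1) * (b + INR j) ^ 2))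
  end.

Definition hyp (a b : R) : R := Series (hyp_term a b).

Lemma hyp_term_pos (a b : R) (k : nat) : 0 < a -> 0 < b -> 0 < hyp_term a b k.
Proof.
  intros Ha Hb; induction k as [|k IH]; simpl; [lra|].
  pose proof (pos_INR k).
  apply Rmult_lt_0_compat; [exact IH|].
  apply Rdiv_lt_0_compat; repeat apply Rmult_lt_0_compat; lra.
Qed.

(** From a <= 2b and 1 <= b each ratio of consecutive terms is at most 1/2. These hypotheses cover
    both a = 1/2 and the pair a = 1/2 + 2c, b = 1 + c. The factor 1/b, won from the first ratio,
    later forces [hyp] to 1 as b grows. *)
Lemma hyp_term_le (a b : R) (k : nat) : 0 < a <= 2 * b -> 1 <= b ->
  hyp_term a b (S k) <= / b * (1 / 2) ^ S k.
Proof.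
  intros Ha Hb; induction k as [|k IH].
  - simpl; apply Rmult_le_reg_r with (8 * b ^ 2); [nra|].
    field_simplify; nra.
  - assert (Hk := pos_INR (S k)).
    change (hyp_term a b (S (S k))) with (hyp_term a b (S k) *
      ((a + INR (S k)) * (INR (S k) + 1 / 2) ^ 2
        / (4 * (INR (S k) + 1) * (b + INR (S k)) ^ 2))).
    set (x := INR (S k)) in *; clearbody x.
    replace (/ b * (1 / 2) ^ S (S k)) with (/ b * (1 / 2) ^ S k * (1 / 2))
      by (simpl; ring).
    apply Rmult_le_compat; [left; apply hyp_term_pos; lra| |exact IH|].
    + apply Rlt_le, Rdiv_lt_0_compat; repeat apply Rmult_lt_0_compat; lra.
    + apply Rle_div_l; [repeat apply Rmult_lt_0_compat; lra|].
      apply Rle_trans with (2 * (b + x) * ((x + 1) * (b + x))).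
      * apply Rmult_le_compat; [lra|nra|lra|nra].
      * lra.
Qed.

Lemma is_series_geom_half (c : R) : is_series (fun k => c * (1 / 2) ^ S k) c.
Proof.
  apply is_series_ext with (fun k => (c / 2) * (1 / 2) ^ k).
  - intros k; simpl; field.
  - assert (H : is_series (fun k => (c / 2) * (1 / 2) ^ k) (c / 2 * / (1 - 1 / 2))).
    { apply (is_series_scal_l (c / 2) (fun k => (1 / 2) ^ k)), is_series_geom.
      rewrite Rabs_pos_eq; lra. }
    now replace (c / 2 * / (1 - 1 / 2)) with c in H by field.
Qed.

Lemma ex_series_hyp (a b : R) : 0 < a <= 2 * b -> 1 <= b -> ex_series (hyp_term a b).
Proof.
  intros Ha Hb; apply ex_series_incr_1.
  apply (@ex_series_le R_AbsRing R_CompleteNormedModule)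
    with (fun k => / b * (1 / 2) ^ S k).
  - intros k; unfold norm; simpl; unfold abs; simpl.
    rewrite Rabs_pos_eq; [now apply hyp_term_le|].
    left; apply (hyp_term_pos a b (S k)); lra.
  - eexists; apply is_series_geom_half.
Qed.

Lemma is_series_hyp (a b : R) : 0 < a <= 2 * b -> 1 <= b ->
  is_series (hyp_term a b) (hyp a b).
Proof. intros Ha Hb; now apply Series_correct, ex_series_hyp. Qed.

Lemma hyp_bounds (a b : R) : 0 < a <= 2 * b -> 1 <= b -> 1 <= hyp a b <= 1 + / b.
Proof.
  intros Ha Hb; unfold hyp; rewrite Series_incr_1 by now apply ex_series_hyp.
  assert (Hp : forall k, 0 <= hyp_term a b (S k))
    by (intros k; left; apply hyp_term_pos; lra).
  rewrite <- (is_series_unique _ _ (is_series_geom_half (/ b))).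
  split; simpl (hyp_term a b 0).
  - assert (0 <= Series (fun k => hyp_term a b (S k))); [|lra].
    rewrite <- (Rmult_0_l (Series (fun k => hyp_term a b (S k)))), <- Series_scal_l.
    apply Series_le; [intros k; specialize (Hp k); lra|].
    apply (ex_series_incr_1 (hyp_term a b)); now apply ex_series_hyp.
  - apply Rplus_le_compat_l, Series_le.
    + intros k; split; [apply Hp|now apply hyp_term_le].
    + eexists; apply is_series_geom_half.
Qed.

(** Contiguity in a, and likewise in b below: a shifted term is a rational multiple of the original
    one, so telescoping identities reduce to identities of rational functions. *)
Lemma hyp_term_incr_a (a b : R) (k : nat) : 0 < a -> 0 < b ->
  hyp_term (a + 1) b k = hyp_term a b k * ((a + INR k) / a).
Proof.
  intros Ha Hb; induction k as [|k IH]; [simpl; field; lra|].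
  simpl hyp_term; rewrite IH, S_INR; pose proof (pos_INR k).
  field; repeat split; lra.
Qed.

Lemma hyp_term_incr_b (a b : R) (k : nat) : 0 < b ->
  hyp_term a (b + 1) k = hyp_term a b k * (b / (b + INR k)) ^ 2.
Proof.
  intros Hb; induction k as [|k IH]; [simpl; field; lra|].
  simpl hyp_term; rewrite IH, S_INR; pose proof (pos_INR k).
  field; repeat split; lra.
Qed.

Lemma is_series_telescope (f U : nat -> R) : (forall k, f k = U (S k) - U k) ->
  U O = 0 -> is_lim_seq U 0 -> is_series f 0.
Proof.
  intros Hf U0 HU; change (is_lim_seq (sum_n f) 0).
  apply is_lim_seq_ext with (fun n => U (S n)).
  - intros n; rewrite sum_n_Reals.
    induction n as [|n IH]; simpl; [rewrite Hf; lra|rewrite <- IH, Hf; ring].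
  - now apply -> (is_lim_seq_incr_1 U).
Qed.

Lemma is_lim_seq_bounded_mult (u v : nat -> R) (C : R) : (forall k, Rabs (u k) <= C) ->
  is_lim_seq v 0 -> is_lim_seq (fun k => u k * v k) 0.
Proof.
  intros Hu Hv; apply is_lim_seq_abs_0.
  apply is_lim_seq_le_le with (fun _ => 0) (fun k => C * Rabs (v k)).
  - intros k; split; [apply Rabs_pos|].
    rewrite Rabs_mult; apply Rmult_le_compat_r; [apply Rabs_pos|apply Hu].
  - apply is_lim_seq_const.
  - replace (Finite 0) with (Rbar_mult C 0) by (simpl; f_equal; ring).
    apply is_lim_seq_scal_l.
    rewrite <- Rabs_R0; exact (is_lim_seq_abs v 0 Hv).
Qed.

Definition cubic_hyp (c : R) : R := hyp (1 / 2 + 2 * c) (1 + c).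

(* Numerator, up to a factor [k], of the Zeilberger certificate [R0] in [cubic_hyp_shift]; its coefficients were
   found by solving the telescoping equation for an unknown cubic in [k]. *)
Definition cubic_cert (c k : R) : R :=
  (- 55 / 8 + 739 * c + 4597 / 2 * c ^ 2 + 2498 * c ^ 3 + 1152 * c ^ 4 + 192 * c ^ 5)
  + (387 / 4 + 1565 * c + 3023 * c ^ 2 + 1992 * c ^ 3 + 432 * c ^ 4) * k
  + (219 / 2 + 928 * c + 1070 * c ^ 2 + 328 * c ^ 3) * k ^ 2
  + (29 + 164 * c + 84 * c ^ 2) * k ^ 3.

(** Numerator and denominator both have degree 6 in c and leading coefficient 16, so the ratio tends
    to 1. *)
Definition cubic_ratio (c : R) : R :=
  (3 / 2 + 2 * c) * (5 / 2 + 2 * c) * (9 / 2 + 2 * c) * (11 / 2 + 2 * c) * (5 / 2 + c) ^ 2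
  / (16 * ((1 + c) * (2 + c) * (3 + c)) ^ 2).

(** Shifting c by 3 raises the upper parameter A = 1/2 + 2c by 6 and the lower ones by 3. Of the
    denominators A, ..., A + 5 so produced, [cubic_ratio] cancels four; the prefactor clears A, A +
    3 and the 16. *)
Lemma cubic_hyp_term_shift (c : R) (k : nat) : 0 <= c ->
  16 * (1 / 2 + 2 * c) * (7 / 2 + 2 * c) * cubic_ratio c
    * hyp_term (1 / 2 + 2 * (c + 3)) (1 + (c + 3)) k =
  hyp_term (1 / 2 + 2 * c) (1 + c) k * (c + 5 / 2) ^ 2 *
  ((1 / 2 + 2 * c + INR k) * (3 / 2 + 2 * c + INR k) * (5 / 2 + 2 * c + INR k)
   * (7 / 2 + 2 * c + INR k) * (9 / 2 + 2 * c + INR k) * (11 / 2 + 2 * c + INR k))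
  / ((1 + c + INR k) * (2 + c + INR k) * (3 + c + INR k)) ^ 2.
Proof.
  intros Hc; unfold cubic_ratio; pose proof (pos_INR k).
  replace (1 / 2 + 2 * (c + 3)) with (1 / 2 + 2 * c + 1 + 1 + 1 + 1 + 1 + 1) by ring.
  replace (1 + (c + 3)) with (1 + c + 1 + 1 + 1) by ring.
  rewrite !hyp_term_incr_a by lra; rewrite !hyp_term_incr_b by lra.
  field; repeat split; lra.
Qed.

(** Creative telescoping: [K] times the difference of the summands is the forward difference of
    [R0 k * t k], which vanishes at k = 0 and at infinity, so the two sums agree. *)
Lemma cubic_hyp_shift (c : R) : 0 <= c ->
  cubic_hyp c = cubic_ratio c * cubic_hyp (c + 3).
Proof.
  intros Hc.
  set (K := 16 * (1 / 2 + 2 * c) * (7 / 2 + 2 * c)).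
  assert (HK : 0 < K) by (unfold K; nra).
  set (t := hyp_term (1 / 2 + 2 * c) (1 + c)).
  assert (Ht : is_series t (cubic_hyp c)) by (apply is_series_hyp; lra).
  assert (Ht3 : is_series (hyp_term (1 / 2 + 2 * (c + 3)) (1 + (c + 3)))
    (cubic_hyp (c + 3))) by (apply is_series_hyp; lra).
  set (R0 := fun k => INR k * cubic_cert c (INR k)
    / ((1 + c + INR k) * (2 + c + INR k)) ^ 2).
  assert (HR : is_lim_seq (fun k => R0 k * t k) 0).
  (* [R0] is bounded because [cubic_cert] has degree 3 in k against a denominator of degree 4.
     [cubic_cert c 1] is the sum of the coefficients, and the 100 makes up for the negative constant
     -55/8. *)
  { apply is_lim_seq_bounded_mult with (100 + cubic_cert c 1);
      [|now apply ex_series_lim_0; eexists; apply Ht].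
    intros k; unfold R0; pose proof (pos_INR k) as Hk.
    set (x := INR k) in *; clearbody x.
    assert (Hd : 0 < ((1 + c + x) * (2 + c + x)) ^ 2) by (apply pow_lt; nra).
    assert (Hd4 : (1 + x) ^ 4 <= ((1 + c + x) * (2 + c + x)) ^ 2).
    { replace ((1 + x) ^ 4) with (((1 + x) * (1 + x)) ^ 2) by ring.
      apply pow_incr; split; [nra|]; apply Rmult_le_compat; lra. }
    assert (Hc2 := pow_le c 2 Hc); assert (Hc3 := pow_le c 3 Hc);
    assert (Hc4 := pow_le c 4 Hc); assert (Hc5 := pow_le c 5 Hc).
    assert (Hcert : Rabs (cubic_cert c x) <= (100 + cubic_cert c 1) * (1 + x) ^ 3).
    { unfold cubic_cert.
      set (y0 := 739 * c + 4597 / 2 * c ^ 2 + 2498 * c ^ 3 + 1152 * c ^ 4 + 192 * c ^ 5).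
      set (y1 := 387 / 4 + 1565 * c + 3023 * c ^ 2 + 1992 * c ^ 3 + 432 * c ^ 4).
      set (y2 := 219 / 2 + 928 * c + 1070 * c ^ 2 + 328 * c ^ 3).
      set (y3 := 29 + 164 * c + 84 * c ^ 2).
      replace (- 55 / 8 + 739 * c + 4597 / 2 * c ^ 2 + 2498 * c ^ 3 + 1152 * c ^ 4
        + 192 * c ^ 5) with (y0 - 55 / 8) by (unfold y0; field).
      assert (0 <= y0) by (unfold y0; lra). assert (0 <= y1) by (unfold y1; lra).
      assert (0 <= y2) by (unfold y2; lra). assert (0 <= y3) by (unfold y3; lra).
      clearbody y0 y1 y2 y3.
      assert (Hx2 := pow_le x 2 Hk); assert (Hx3 := pow_le x 3 Hk).
      replace ((1 + x) ^ 3) with (1 + 3 * x + 3 * x ^ 2 + x ^ 3) by ring.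
      set (w := 1 + 3 * x + 3 * x ^ 2 + x ^ 3).
      assert (y0 <= y0 * w) by (unfold w; nra).
      assert (y1 * x <= y1 * w) by (apply Rmult_le_compat_l; unfold w; lra).
      assert (y2 * x ^ 2 <= y2 * w) by (apply Rmult_le_compat_l; unfold w; lra).
      assert (y3 * x ^ 3 <= y3 * w) by (apply Rmult_le_compat_l; unfold w; lra).
      assert (0 <= y1 * x) by nra. assert (0 <= y2 * x ^ 2) by nra.
      assert (0 <= y3 * x ^ 3) by nra.
      assert (1 <= w) by (unfold w; lra).
      apply Rabs_le; split; ring_simplify; lra. }
    assert (HC : 0 <= 100 + cubic_cert c 1) by (unfold cubic_cert; lra).
    rewrite Rabs_div, (Rabs_pos_eq (_ ^ 2)), Rabs_mult, (Rabs_pos_eq x) by lra.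
    apply Rle_div_l; [exact Hd|].
    apply Rle_trans with ((1 + x) * ((100 + cubic_cert c 1) * (1 + x) ^ 3)).
    - apply Rmult_le_compat; [lra|apply Rabs_pos|lra|exact Hcert].
    - replace ((1 + x) * ((100 + cubic_cert c 1) * (1 + x) ^ 3))
        with ((100 + cubic_cert c 1) * (1 + x) ^ 4) by ring.
      now apply Rmult_le_compat_l. }
  assert (H0 : is_series (fun k => K * cubic_ratio c
      * hyp_term (1 / 2 + 2 * (c + 3)) (1 + (c + 3)) k - K * t k) 0).
  { apply is_series_telescope with (fun k => R0 k * t k); [|unfold R0; simpl; field|exact HR].
    - intros k; unfold K; rewrite cubic_hyp_term_shift by exact Hc; fold t.
      unfold R0, cubic_cert.
      replace (t (S k)) with (t k * ((1 / 2 + 2 * c + INR k) * (INR k + 1 / 2) ^ 2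
        / (4 * (INR k + 1) * (1 + c + INR k) ^ 2))) by reflexivity.
      rewrite S_INR; pose proof (pos_INR k).
      field; repeat split; lra.
    - lra. }
  assert (H1 := is_series_minus _ _ _ _ (is_series_scal_l (K * cubic_ratio c) _ _ Ht3)
    (is_series_scal_l K _ _ Ht)).
  apply is_series_unique in H0; apply is_series_unique in H1.
  assert (H2 : K * cubic_ratio c * cubic_hyp (c + 3) - K * cubic_hyp c = 0)
    by (rewrite <- H0 at 1; symmetry; exact H1).
  apply Rmult_eq_reg_l with K; lra.
Qed.

(** * The minimal solution *)

(** Creative telescoping again, now in b: the combination of the three summands is a forward
    difference in k. *)
Lemma hyp_recurrence (b : R) : 1 <= b ->
  4 * (b + 1 / 2) ^ 4 / (b * (b + 1)) ^ 2 * hyp (1 / 2) (b + 1 + 1)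
  - (40 * b ^ 2 + 2) / b ^ 2 * hyp (1 / 2) (b + 1) + 36 * hyp (1 / 2) b = 0.
Proof.
  intros Hb.
  assert (H0 : is_series (hyp_term (1 / 2) b) (hyp (1 / 2) b))
    by (apply is_series_hyp; lra).
  assert (H1 : is_series (hyp_term (1 / 2) (b + 1)) (hyp (1 / 2) (b + 1)))
    by (apply is_series_hyp; lra).
  assert (H2 : is_series (hyp_term (1 / 2) (b + 1 + 1)) (hyp (1 / 2) (b + 1 + 1)))
    by (apply is_series_hyp; lra).
  assert (Hlim : is_lim_seq (hyp_term (1 / 2) b) 0)
    by (apply ex_series_lim_0; eexists; apply H0).
  (* The telescoping certificate times the term. Its factor k gives the value 0 at k = 0, and b >= 1
     bounds it by 72. *)
  assert (HU : is_lim_seq (fun k => - (INR k * (48 * INR k + 64 * b + 8) / (b + INR k) ^ 2)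
    * hyp_term (1 / 2) b k) 0).
  { apply is_lim_seq_bounded_mult with 72; [|exact Hlim].
    intros k; pose proof (pos_INR k) as Hk; set (x := INR k) in *; clearbody x.
    rewrite Rabs_Ropp, Rabs_pos_eq.
    - apply Rle_div_l; [apply pow_lt; lra|]. nra.
    - apply Rmult_le_pos; [nra|]. left; apply Rinv_0_lt_compat, pow_lt; lra. }
  assert (H := is_series_plus _ _ _ _
    (is_series_minus _ _ _ _
      (is_series_scal_l (4 * (b + 1 / 2) ^ 4 / (b * (b + 1)) ^ 2) _ _ H2)
      (is_series_scal_l ((40 * b ^ 2 + 2) / b ^ 2) _ _ H1))
    (is_series_scal_l 36 _ _ H0)).
  eapply is_series_telescope in HU; [|intros k; reflexivity|simpl; field; lra].
  apply is_series_unique in H; apply is_series_unique in HU.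
  rewrite <- HU; symmetry; etransitivity; [|exact H].
  apply Series_ext; intros k.
  unfold plus, opp, scal; simpl; unfold mult; simpl.
  change (match k with O => 1 | S _ => INR k + 1 end) with (INR (S k)).
  rewrite !hyp_term_incr_b, S_INR by lra.
  pose proof (pos_INR k); field; repeat split; lra.
Qed.

Fixpoint poch (a : R) (n : nat) : R :=
  match n with
  | O => 1
  | S m => poch a m * (a + INR m)
  end.

Lemma poch_S (a : R) (n : nat) : poch a (S n) = poch a n * (a + INR n).
Proof. reflexivity. Qed.

Lemma poch_pos (a : R) (n : nat) : 0 < a -> 0 < poch a n.
Proof.
  intros Ha; induction n as [|n IH]; simpl; [lra|].
  pose proof (pos_INR n); apply Rmult_lt_0_compat; lra.
Qed.

(** The square of binom(2n, n) / 4^n; [poch 1 n] is n!. *)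
Definition half_sq (n : nat) : R := (poch (1 / 2) n / poch 1 n) ^ 2.

Lemma half_sq_S (n : nat) :
  half_sq (S n) = half_sq n * ((1 / 2 + INR n) / (1 + INR n)) ^ 2.
Proof.
  unfold half_sq; simpl poch; assert (H := poch_pos 1 n Rlt_0_1).
  pose proof (pos_INR n); field; lra.
Qed.

Lemma half_sq_pos (n : nat) : 0 < half_sq n.
Proof. apply pow_lt, Rdiv_lt_0_compat; apply poch_pos; lra. Qed.

Definition minsol (m : nat) : R := half_sq m * hyp (1 / 2) (INR m + 1).

(** This is [hyp_recurrence] at b = m + 1, multiplied by [half_sq m] and (m + 1/2)^2. *)
Lemma minsol_recurrence (m : nat) :
  (2 * INR m + 3) ^ 2 * minsol (S (S m))
  = (40 * INR (S m) ^ 2 + 2) * minsol (S m) - 9 * (2 * INR m + 1) ^ 2 * minsol m.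
Proof.
  unfold minsol; rewrite !half_sq_S, !S_INR; pose proof (pos_INR m) as Hm.
  assert (H := hyp_recurrence (INR m + 1) ltac:(lra)).
  set (T2 := hyp _ (INR m + 1 + 1 + 1)) in *.
  set (T1 := hyp _ (INR m + 1 + 1)) in *. set (T0 := hyp _ (INR m + 1)) in *.
  set (x := INR m) in *; clearbody T0 T1 T2 x.
  apply Rminus_diag_uniq.
  transitivity (half_sq m * (x + 1 / 2) ^ 2 * (4 * (x + 1 + 1 / 2) ^ 4
    / ((x + 1) * (x + 1 + 1)) ^ 2 * T2 - (40 * (x + 1) ^ 2 + 2) / (x + 1) ^ 2 * T1 + 36 * T0)).
  - field; lra.
  - rewrite H; ring.
Qed.

Lemma minsol_pos (m : nat) : 0 < minsol m.
Proof.
  apply Rmult_lt_0_compat; [apply half_sq_pos|].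
  pose proof (pos_INR m).
  destruct (hyp_bounds (1 / 2) (INR m + 1)); lra.
Qed.

Lemma minsol_0 : minsol 0 = cubic_hyp 0.
Proof.
  unfold minsol, cubic_hyp, half_sq; simpl.
  replace (1 / 2 + 2 * 0) with (1 / 2) by field; rewrite (Rplus_comm 0 1); field.
Qed.

(** Termwise, the factor 1 - 1/(4(k+1)^2) equals (k+1/2)(k+3/2)/(k+1)^2, which raises the upper
    parameter from 1/2 to 5/2 and the lower ones from 1 to 2. *)
Lemma minsol_0_minus_1 : minsol 0 - minsol 1 = 3 / 4 * cubic_hyp 1.
Proof.
  unfold minsol, cubic_hyp, half_sq, hyp; simpl poch; simpl INR.
  replace (1 / 2 + 2 * 1) with (1 / 2 + 1 + 1) by ring; rewrite Rplus_0_l.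
  rewrite <- !Series_scal_l, <- Series_minus.
  - apply Series_ext; intros k; pose proof (pos_INR k).
    rewrite !hyp_term_incr_a, hyp_term_incr_b by lra; field; lra.
  - apply (ex_series_scal_l _ (hyp_term (1 / 2) 1)), ex_series_hyp; lra.
  - apply (ex_series_scal_l _ (hyp_term (1 / 2) (1 + 1))), ex_series_hyp; lra.
Qed.

(** * Infinite products for the cubic series *)

Lemma is_lim_seq_inv_INR : is_lim_seq (fun n => / INR n) 0.
Proof.
  replace (Finite 0) with (Rbar_inv p_infty) by reflexivity.
  apply is_lim_seq_inv; [apply is_lim_seq_INR|easy].
Qed.

Lemma is_lim_seq_hyp_1 (a b : nat -> R) : (forall n, 0 < a n <= 2 * b n) ->
  (forall n, INR (S n) <= b n) -> is_lim_seq (fun n => hyp (a n) (b n)) 1.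
Proof.
  intros Ha Hb; apply is_lim_seq_le_le with (fun _ => 1) (fun n => 1 + / INR (S n)).
  - intros n; specialize (Ha n); specialize (Hb n); rewrite S_INR in *.
    pose proof (pos_INR n).
    destruct (hyp_bounds (a n) (b n)) as [H1 H2]; [lra|lra|].
    split; [lra|]; apply Rle_trans with (1 := H2).
    apply Rplus_le_compat_l, Rinv_le_contravar; lra.
  - apply is_lim_seq_const.
  - replace (Finite 1) with (Finite (1 + 0)) by (f_equal; ring).
    apply is_lim_seq_plus'; [apply is_lim_seq_const|].
    apply -> (is_lim_seq_incr_1 (fun n => / INR n)); apply is_lim_seq_inv_INR.
Qed.

Fixpoint cubic_prod (i : R) (n : nat) : R :=
  match n with
  | O => 1
  | S m => cubic_prod i m * cubic_ratio (i + 3 * INR m)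
  end.

(** Iterating [cubic_hyp_shift] n times leaves the tail factor [cubic_hyp (i + 3 * INR n)], which
    tends to 1. *)
Lemma cubic_prod_lim (i : R) : 0 <= i -> is_lim_seq (cubic_prod i) (cubic_hyp i).
Proof.
  intros Hi.
  assert (H : forall n, cubic_hyp i = cubic_prod i n * cubic_hyp (i + 3 * INR n)).
  { induction n as [|n IH]; [simpl; rewrite Rmult_0_r, Rplus_0_r; ring|].
    pose proof (pos_INR n); rewrite IH, cubic_hyp_shift by lra.
    simpl cubic_prod; rewrite S_INR.
    replace (i + 3 * (INR n + 1)) with (i + 3 * INR n + 3) by ring; ring. }
  assert (Hpos : forall n, 1 <= cubic_hyp (i + 3 * INR n)).
  { intros n; pose proof (pos_INR n); apply hyp_bounds; lra. }
  apply is_lim_seq_ext with (fun n => cubic_hyp i / cubic_hyp (i + 3 * INR n)).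
  - intros n; specialize (Hpos n); rewrite (H n) at 1; field; lra.
  - replace (Finite (cubic_hyp i)) with (Finite (cubic_hyp i / 1)) by (f_equal; field).
    apply is_lim_seq_div'; [apply is_lim_seq_const| |lra].
    apply is_lim_seq_hyp_1; intros n; pose proof (pos_INR n); rewrite ?S_INR; lra.
Qed.

(** * Stirling asymptotics *)

Lemma nonneg_of_deriv (f f' : R -> R) (t : R) : 0 <= t ->
  (forall x, 0 <= x <= t -> is_derive f x (f' x)) ->
  (forall x, 0 <= x <= t -> 0 <= f' x) -> f 0 = 0 -> 0 <= f t.
Proof.
  intros Ht Hd Hp H0.
  destruct (MVT_gen f 0 t f') as [x [Hx Hf]]; rewrite ?Rmin_left, ?Rmax_right in * by lra.
  - intros x Hx; apply Hd; lra.
  - intros x Hx; apply continuity_pt_filterlim.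
    apply (ex_derive_continuous f); eexists; apply Hd; lra.
  - specialize (Hp x Hx); nra.
Qed.

(** At t = 1/n the Padé approximant 2t/(2 + t) is 1/(n + 1/2), which matches the weight n + 1/2 in
    Stirling's formula; the cubic error makes the remaining differences summable. *)
Lemma ln_1_plus_bounds (t : R) : 0 <= t ->
  2 * t / (2 + t) <= ln (1 + t) <= 2 * t / (2 + t) + t ^ 3 / 4.
Proof.
  intros Ht; split.
  - cut (0 <= ln (1 + t) - 2 * t / (2 + t)); [lra|].
    apply (nonneg_of_deriv (fun x => ln (1 + x) - 2 * x / (2 + x))
      (fun x => x ^ 2 / ((1 + x) * (2 + x) ^ 2))); [lra| | |].
    + intros x Hx; auto_derive; [lra|field; lra].
    + intros x Hx; apply Rmult_le_pos; [nra|].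
      left; apply Rinv_0_lt_compat, Rmult_lt_0_compat; [lra|apply pow_lt; lra].
    + rewrite !Rplus_0_r, ln_1; field.
  - cut (0 <= 2 * t / (2 + t) + t ^ 3 / 4 - ln (1 + t)); [lra|].
    apply (nonneg_of_deriv (fun x => 2 * x / (2 + x) + x ^ 3 / 4 - ln (1 + x))
      (fun x => x ^ 2 * (3 / 4 - / ((1 + x) * (2 + x) ^ 2)))); [lra| | |].
    + intros x Hx; auto_derive; [lra|field; lra].
    + intros x Hx; apply Rmult_le_pos; [nra|].
      assert (/ ((1 + x) * (2 + x) ^ 2) <= / 2); [|lra].
      apply Rinv_le_contravar; nra.
    + rewrite !Rplus_0_r, ln_1; field.
Qed.

(** The logarithm of n! e^n / n^(n + 1/2). *)
Definition stirling (n : nat) : R :=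
  ln (poch 1 n) - (INR n + 1 / 2) * ln (INR n) + INR n.

(** The difference is (n + 1/2) ln(1 + 1/n) - 1. Its upper bound (n + 1/2)/(4n^3) is compared with a
    telescoping expression; the constant 3/4 makes that comparison an equality at n = 1. *)
Lemma stirling_step (n : nat) : (0 < n)%nat ->
  0 <= stirling n - stirling (S n) <= 3 / 4 * (/ INR n - / INR (S n)).
Proof.
  intros Hn; assert (Hx := le_INR 1 n Hn); change (INR 1) with 1 in Hx.
  apply lt_0_INR in Hn; unfold stirling; simpl poch; rewrite S_INR.
  set (x := INR n) in *.
  rewrite ln_mult by (try apply poch_pos; lra).
  assert (Hi := Rinv_0_lt_compat x Hn).
  rewrite (Rplus_comm 1 x); replace (ln (x + 1)) with (ln (1 + / x) + ln x)
    by (rewrite <- ln_mult by lra; f_equal; field; lra).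
  destruct (ln_1_plus_bounds (/ x)) as [H1 H2]; [lra|].
  replace (2 * / x / (2 + / x)) with (/ (x + 1 / 2)) in H1, H2 by (field; lra).
  assert (H1' := Rmult_le_compat_l (x + 1 / 2) _ _ ltac:(lra) H1).
  assert (H2' := Rmult_le_compat_l (x + 1 / 2) _ _ ltac:(lra) H2).
  rewrite Rmult_plus_distr_l in H2'.
  rewrite Rinv_r in H1', H2' by lra.
  split; [lra|].
  assert ((x + 1 / 2) * ((/ x) ^ 3 / 4) <= 3 / 4 * (/ x - / (x + 1))); [|lra].
  apply Rminus_le_0.
  replace (3 / 4 * (/ x - / (x + 1)) - (x + 1 / 2) * ((/ x) ^ 3 / 4))
    with ((4 * x ^ 2 - 3 * x - 1) / (8 * x ^ 3 * (x + 1))) by (field; lra).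
  apply Rmult_le_pos; [nra|].
  left; apply Rinv_0_lt_compat; repeat apply Rmult_lt_0_compat; lra.
Qed.

Lemma stirling_lim : exists l : R, is_lim_seq stirling l.
Proof.
  destruct (ex_finite_lim_seq_decr (fun n => stirling (S n)) (stirling 1 - 3 / 4)) as [l Hl].
  - intros n; destruct (stirling_step (S n)); [lia|lra].
  (* [stirling n] minus 3/(4n) increases for n >= 1, which bounds the decreasing sequence from
     below. *)
  - intros n; cut (stirling 1 - 3 / 4 <= stirling (S n) - 3 / 4 * / INR (S n)).
    { assert (0 < / INR (S n)) by (apply Rinv_0_lt_compat, lt_0_INR; lia); lra. }
    induction n as [|n IH]; [simpl INR; lra|].
    destruct (stirling_step (S n)); [lia|lra].
  - exists l; now apply is_lim_seq_incr_1.
Qed.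

Lemma poch_double (a : R) (n : nat) :
  poch (2 * a) (2 * n) = 4 ^ n * poch a n * poch (a + 1 / 2) n.
Proof.
  induction n as [|n IH]; [simpl; ring|].
  replace (2 * S n)%nat with (S (S (2 * n))) by lia.
  rewrite !poch_S, IH, S_INR, mult_INR; simpl; field.
Qed.

Lemma poch_triple (n : nat) :
  poch 1 (3 * n) = 27 ^ n * poch (1 / 3) n * poch (2 / 3) n * poch 1 n.
Proof.
  induction n as [|n IH]; [simpl; ring|].
  replace (3 * S n)%nat with (S (S (S (3 * n)))) by lia.
  rewrite !poch_S, IH, !S_INR, mult_INR; simpl; field.
Qed.

Lemma is_lim_seq_dilate (u : nat -> R) (l : Rbar) (r : nat) : (0 < r)%nat ->
  is_lim_seq u l -> is_lim_seq (fun n => u (r * n)%nat) l.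
Proof.
  intros Hr; apply (is_lim_seq_subseq u l (fun n => (r * n)%nat)).
  intros P [N HN]; exists N; intros n Hn; apply HN; nia.
Qed.

Lemma is_lim_seq_exp (u : nat -> R) (l : R) :
  is_lim_seq u l -> is_lim_seq (fun n => exp (u n)) (exp l).
Proof.
  intros H; apply (is_lim_seq_continuous exp u l); [|exact H].
  apply derivable_continuous_pt, derivable_pt_exp.
Qed.

(** By [poch_triple] this is (3n)! / (27^n n!^3). *)
Definition third_pair (n : nat) : R := poch (1 / 3) n * poch (2 / 3) n / poch 1 n ^ 2.

Lemma third_pair_S (n : nat) : third_pair (S n) =
  third_pair n * ((1 / 3 + INR n) * (2 / 3 + INR n) / (1 + INR n) ^ 2).
Proof.
  unfold third_pair; simpl poch; assert (H := poch_pos 1 n Rlt_0_1).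
  pose proof (pos_INR n); field; lra.
Qed.

Lemma third_pair_pos (n : nat) : 0 < third_pair n.
Proof.
  apply Rdiv_lt_0_compat; [apply Rmult_lt_0_compat|apply pow_lt]; apply poch_pos; lra.
Qed.

(** Duplication rewrites [half_sq] through (2n)! and n!; in Stirling's form the exponentials and
    powers cancel up to 1/n and a constant. Triplication does the same for [third_pair] below. *)
Lemma half_sq_stirling (n : nat) : (0 < n)%nat ->
  INR n * half_sq n = exp (2 * stirling (2 * n) - 4 * stirling n + ln 2).
Proof.
  intros Hn; assert (Hx := lt_0_INR n Hn).
  assert (H1 := poch_pos 1 n Rlt_0_1); assert (H2 := poch_pos 1 (2 * n) Rlt_0_1).
  assert (H3 := poch_pos (1 / 2) n ltac:(lra)).
  rewrite <- (exp_ln (INR n * half_sq n))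
    by (apply Rmult_lt_0_compat; [lra|apply half_sq_pos]).
  f_equal; unfold half_sq, stirling.
  assert (H := poch_double (1 / 2) n).
  replace (2 * (1 / 2)) with 1 in H by field; replace (1 / 2 + 1 / 2) with 1 in H by field.
  rewrite H, mult_INR; change (INR 2) with 2.
  assert (H4 : 0 < 4 ^ n) by (apply pow_lt; lra).
  rewrite ln_mult, ln_pow, ln_div by (try apply pow_lt; try apply Rdiv_lt_0_compat; lra).
  rewrite (ln_mult (_ * _)), (ln_mult (4 ^ n)), ln_pow, (ln_mult 2)
    by (try apply Rmult_lt_0_compat; lra).
  replace (ln 4) with (2 * ln 2) by (replace 4 with (2 * 2) by ring; rewrite ln_mult; lra).
  change (INR 2) with 2; field.
Qed.

Lemma third_pair_stirling (n : nat) : (0 < n)%nat ->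
  INR n * third_pair n = exp (stirling (3 * n) - 3 * stirling n + 1 / 2 * ln 3).
Proof.
  intros Hn; assert (Hx := lt_0_INR n Hn).
  assert (H1 := poch_pos 1 n Rlt_0_1); assert (H2 := poch_pos 1 (3 * n) Rlt_0_1).
  assert (H3 := poch_pos (1 / 3) n ltac:(lra)).
  assert (H4 := poch_pos (2 / 3) n ltac:(lra)).
  rewrite <- (exp_ln (INR n * third_pair n))
    by (apply Rmult_lt_0_compat; [lra|apply third_pair_pos]).
  f_equal; unfold third_pair, stirling.
  rewrite poch_triple, mult_INR; replace (INR 3) with 3 by (simpl; ring).
  assert (H5 : 0 < 27 ^ n) by (apply pow_lt; lra).
  rewrite ln_mult, ln_div, ln_mult, ln_pow
    by (try apply pow_lt; try apply Rdiv_lt_0_compat; try apply pow_lt;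
        try apply Rmult_lt_0_compat; lra).
  rewrite (ln_mult (_ * _ * _)), (ln_mult (_ * _) (poch (2 / 3) n)), (ln_mult (27 ^ n)),
    ln_pow, (ln_mult 3) by (repeat apply Rmult_lt_0_compat; lra).
  replace (ln 27) with (3 * ln 3)
    by (replace 27 with (3 * (3 * 3)) by ring; rewrite !ln_mult; lra).
  change (INR 2) with 2; field.
Qed.

(** With l the limit of [stirling], the two limits are 2 exp(-2l) and sqrt(3) exp(-2l); eliminating
    l relates them without its value. *)
Lemma half_sq_third_pair_lim : exists w e, 0 < w /\ 0 < e /\ e ^ 2 = 3 / 4 * w ^ 2 /\
  is_lim_seq (fun n => INR n * half_sq n) w /\ is_lim_seq (fun n => INR n * third_pair n) e.
Proof.
  destruct stirling_lim as [l Hl].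
  exists (exp (2 * l - 4 * l + ln 2)), (exp (l - 3 * l + 1 / 2 * ln 3)).
  split; [apply exp_pos|split; [apply exp_pos|split; [|split]]].
  - simpl; rewrite !Rmult_1_r, <- !exp_plus.
    replace (3 / 4) with (exp (ln 3 - (ln 2 + ln 2))).
    + rewrite <- exp_plus; f_equal; field.
    + unfold Rminus; rewrite exp_plus, exp_Ropp, exp_plus, !exp_ln by lra; field.
  - apply is_lim_seq_incr_1.
    apply is_lim_seq_ext with
      (fun n => exp (2 * stirling (2 * S n) - 4 * stirling (S n) + ln 2)).
    { intros n; symmetry; apply half_sq_stirling; lia. }
    apply (is_lim_seq_incr_1
      (fun n => exp (2 * stirling (2 * n) - 4 * stirling n + ln 2))), is_lim_seq_exp.
    apply is_lim_seq_plus'; [|apply is_lim_seq_const].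
    apply is_lim_seq_minus'.
    + apply (is_lim_seq_scal_l _ 2 l), (is_lim_seq_dilate stirling); [lia|exact Hl].
    + apply (is_lim_seq_scal_l _ 4 l), Hl.
  - apply is_lim_seq_incr_1.
    apply is_lim_seq_ext with
      (fun n => exp (stirling (3 * S n) - 3 * stirling (S n) + 1 / 2 * ln 3)).
    { intros n; symmetry; apply third_pair_stirling; lia. }
    apply (is_lim_seq_incr_1
      (fun n => exp (stirling (3 * n) - 3 * stirling n + 1 / 2 * ln 3))), is_lim_seq_exp.
    apply is_lim_seq_plus'; [|apply is_lim_seq_const].
    apply is_lim_seq_minus'.
    + apply (is_lim_seq_dilate stirling); [lia|exact Hl].
    + apply (is_lim_seq_scal_l _ 3 l), Hl.
Qed.

(** * Values of the infinite products *)

(* Each factor of the two products is a ratio of Pochhammer steps; by duplication all of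
   them regroup into [half_sq] and [third_pair]. *)
Lemma cubic_prod_01 (n : nat) :
  cubic_prod 0 n * cubic_prod 1 n * (third_pair n ^ 6 * (3 * INR n + 1) ^ 2) =
  half_sq (2 * n) ^ 2 * half_sq n ^ 4 * third_pair (4 * n) * third_pair (2 * n)
  * ((4 * INR n + 1) * (12 * INR n + 1) * (6 * INR n + 1) ^ 2).
Proof.
  induction n as [|n IH]; [unfold half_sq, third_pair; simpl; field|].
  replace (4 * S n)%nat with (S (S (S (S (4 * n))))) by lia.
  replace (2 * S n)%nat with (S (S (2 * n))) by lia.
  rewrite !half_sq_S, !third_pair_S, !S_INR, !mult_INR.
  replace (INR 2) with 2 by (simpl; ring); replace (INR 4) with 4 by (simpl; ring).
  simpl cubic_prod.
  pose proof (pos_INR n) as Hx; set (x := INR n) in *.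
  set (A := cubic_prod 0 n) in *. set (B := cubic_prod 1 n) in *.
  set (y := third_pair n) in *. set (y4 := third_pair (4 * n)) in *.
  set (y2 := third_pair (2 * n)) in *.
  set (z := half_sq n) in *. set (z2 := half_sq (2 * n)) in *.
  clearbody A B y y4 y2 z z2 x.
  (* The multiplier is the quotient of the polynomial factors of the two sides at n; it brings out
     the left side of the induction hypothesis as a block. *)
  apply Rmult_eq_reg_r with ((4 * x + 1) * (12 * x + 1) * (6 * x + 1) ^ 2
    / ((3 * x + 1) ^ 2)).
  transitivity ((A * B * (y ^ 6 * (3 * x + 1) ^ 2))
    * (cubic_ratio (0 + 3 * x) * cubic_ratio (1 + 3 * x)
       * ((1 / 3 + x) * (2 / 3 + x) / (1 + x) ^ 2) ^ 6 * (3 * (x + 1) + 1) ^ 2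
       * ((4 * x + 1) * (12 * x + 1) * (6 * x + 1) ^ 2) / (3 * x + 1) ^ 4)).
  { field; lra. }
  rewrite IH; unfold cubic_ratio.
  field.
  lra.
  apply Rgt_not_eq, Rdiv_lt_0_compat; repeat apply Rmult_lt_0_compat; lra.
Qed.

Lemma is_lim_seq_homographic (a b c d : R) : c <> 0 ->
  is_lim_seq (fun n => (a * INR n + b) / (c * INR n + d)) (a / c).
Proof.
  intros Hc.
  assert (Hi := is_lim_seq_inv_INR).
  apply is_lim_seq_incr_1.
  apply is_lim_seq_ext_loc with
    (fun n => (a + b * / INR (S n)) / (c + d * / INR (S n))).
  - assert (Hl : is_lim_seq (fun n => c + d * / INR n) c).
    { replace (Finite c) with (Finite (c + d * 0)) by (f_equal; ring).
      apply is_lim_seq_plus'; [apply is_lim_seq_const|].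
      apply (is_lim_seq_scal_l _ d 0), Hi. }
    apply is_lim_seq_incr_1 in Hl.
    assert (Hev : eventually (fun n => c + d * / INR (S n) <> 0)).
    { apply is_lim_seq_spec in Hl; destruct (Hl (mkposreal _ (Rabs_pos_lt _ Hc))) as [N HN].
      exists N; intros n Hn H0; specialize (HN n Hn); simpl in HN.
      change (match n with O => 1 | S _ => INR n + 1 end) with (INR (S n)) in HN.
      rewrite H0, <- Rabs_Ropp in HN; replace (- (0 - c)) with c in HN by ring; lra. }
    destruct Hev as [N HN]; exists N; intros n Hn; specialize (HN n Hn).
    assert (Hx : 0 < INR (S n)) by (apply lt_0_INR; lia).
    set (x := INR (S n)) in *; clearbody x.
    assert (c * x + d <> 0).
    { intros H0; apply HN; replace (c + d * / x) with ((c * x + d) / x) by (field; lra).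
      rewrite H0; field; lra. }
    field; repeat split; try lra; assumption.
  - apply is_lim_seq_div'; [| |exact Hc].
    + replace (Finite a) with (Finite (a + b * 0)) by (f_equal; ring).
      apply is_lim_seq_plus'; [apply is_lim_seq_const|].
      apply (is_lim_seq_scal_l _ b 0), (is_lim_seq_incr_1 (fun n => / INR n)), Hi.
    + replace (Finite c) with (Finite (c + d * 0)) by (f_equal; ring).
      apply is_lim_seq_plus'; [apply is_lim_seq_const|].
      apply (is_lim_seq_scal_l _ d 0), (is_lim_seq_incr_1 (fun n => / INR n)), Hi.
Qed.

Lemma is_lim_seq_inj (u : nat -> R) (l m : R) :
  is_lim_seq u l -> is_lim_seq u m -> l = m.
Proof.
  intros Hl Hm; apply is_lim_seq_unique in Hl; apply is_lim_seq_unique in Hm.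
  apply Rbar_finite_eq; congruence.
Qed.

Lemma is_lim_seq_pow (u : nat -> R) (l : R) (k : nat) :
  is_lim_seq u l -> is_lim_seq (fun n => u n ^ k) (l ^ k).
Proof.
  intros H; induction k as [|k IH]; simpl; [apply is_lim_seq_const|].
  now apply is_lim_seq_mult'.
Qed.

(** Descends in parallel through the sequence and its claimed limit. Hence limits are stated
    unevaluated, such as 4 / 1, and n is written [1 * INR n + 0]. *)
Ltac lim_rational :=
  lazymatch goal with
  | |- is_lim_seq (fun n => (?a * INR n + ?b) / (?c * INR n + ?d)) _ =>
      apply (is_lim_seq_homographic a b c d); lra
  | |- is_lim_seq (fun n => @?u n * @?v n) (Finite (?l * ?m)) =>
      apply (is_lim_seq_mult' u v l m); lim_rational
  | |- is_lim_seq (fun n => @?u n / @?v n) (Finite (?l / ?m)) =>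
      apply (is_lim_seq_div' u v l m); [lim_rational..|]
  | |- is_lim_seq (fun n => @?u n ^ ?k) (Finite (?l ^ ?k)) =>
      apply (is_lim_seq_pow u l k); lim_rational
  | |- is_lim_seq (fun _ => ?c) _ => apply is_lim_seq_const
  | |- _ => idtac
  end.

(** In the limit [cubic_prod_01] gives 6 w^6 / e^4, with e the limit of [INR n * third_pair n], and
    e^2 = 3/4 w^2 eliminates e. *)
Lemma cubic_hyp_product (w : R) : is_lim_seq (fun n => INR n * half_sq n) w ->
  0 < w -> cubic_hyp 0 * cubic_hyp 1 = 32 / 3 * w ^ 2.
Proof.
  intros Hz Hw.
  destruct half_sq_third_pair_lim as (w' & e & Hw' & He & Hew & Hz' & Hy).
  assert (w' = w) by (eapply is_lim_seq_inj; eassumption); subst w'; clear Hz' Hw'.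
  assert (HP : is_lim_seq (fun n => cubic_prod 0 n * cubic_prod 1 n)
    (cubic_hyp 0 * cubic_hyp 1)) by (apply is_lim_seq_mult'; apply cubic_prod_lim; lra).
  assert (HQ : is_lim_seq (fun n => cubic_prod 0 n * cubic_prod 1 n)
    (/ 32 * (4 / 1) * (12 / 1) * (6 / 3) ^ 2 * (w ^ 2 * w ^ 4 * e * e / e ^ 6))).
  (* Each factor is normalised by its own index: 1/32 undoes the constants of (2n)^2, 4n and 2n, and
     the two denominators [1 * INR n + 0] absorb the surplus n^2. *)
  { apply is_lim_seq_ext_loc with (fun n =>
      / 32 * ((4 * INR n + 1) / (1 * INR n + 0)) * ((12 * INR n + 1) / (1 * INR n + 0))
      * ((6 * INR n + 1) / (3 * INR n + 1)) ^ 2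
      * ((INR (2 * n) * half_sq (2 * n)) ^ 2 * (INR n * half_sq n) ^ 4
         * (INR (4 * n) * third_pair (4 * n)) * (INR (2 * n) * third_pair (2 * n))
         / (INR n * third_pair n) ^ 6)).
    - exists 1%nat; intros n Hn.
      assert (H := cubic_prod_01 n); assert (Hx := lt_0_INR n Hn).
      assert (Hy0 := third_pair_pos n).
      rewrite !mult_INR; replace (INR 2) with 2 by (simpl; ring);
        replace (INR 4) with 4 by (simpl; ring).
      set (y := third_pair n) in *; set (x := INR n) in *.
      apply Rmult_eq_reg_r with (y ^ 6 * (3 * x + 1) ^ 2).
      + rewrite H; field; repeat split; try lra.
      + apply Rgt_not_eq, Rmult_lt_0_compat; apply pow_lt; lra.
    - assert (Hz2 := is_lim_seq_dilate _ _ 2 ltac:(lia) Hz).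
      assert (Hy2 := is_lim_seq_dilate _ _ 2 ltac:(lia) Hy).
      assert (Hy4 := is_lim_seq_dilate _ _ 4 ltac:(lia) Hy).
      cbv beta in Hz2, Hy2, Hy4.
      assert (Hzp := is_lim_seq_pow _ _ 4 Hz); assert (Hyp := is_lim_seq_pow _ _ 6 Hy).
      assert (Hz2p := is_lim_seq_pow _ _ 2 Hz2).
      apply is_lim_seq_mult'; [lim_rational|].
      apply is_lim_seq_div'; [|exact Hyp|].
      { repeat (apply is_lim_seq_mult'; [|assumption]); assumption. }
      apply Rgt_not_eq, pow_lt, He. }
  rewrite (is_lim_seq_inj _ _ _ HP HQ).
  apply Rmult_eq_reg_r with (e ^ 4); [|apply Rgt_not_eq, pow_lt, He].
  transitivity (6 * w ^ 6); [field; lra|].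
  replace (e ^ 4) with ((e ^ 2) ^ 2) by ring; rewrite Hew; field.
Qed.

(** Grows like a constant times n^(1/3), so it is its cube divided by n that has a limit. *)
Definition third_ratio (n : nat) : R := poch (2 / 3) n / poch (1 / 3) n.

Lemma third_ratio_S (n : nat) :
  third_ratio (S n) = third_ratio n * ((2 / 3 + INR n) / (1 / 3 + INR n)).
Proof.
  unfold third_ratio; rewrite !poch_S; assert (H := poch_pos (1 / 3) n ltac:(lra)).
  pose proof (pos_INR n); field; lra.
Qed.

Lemma cubic_prod_pos (i : R) (n : nat) : 0 <= i -> 0 < cubic_prod i n.
Proof.
  intros Hi; induction n as [|n IH]; simpl; [lra|].
  apply Rmult_lt_0_compat; [exact IH|].
  pose proof (pos_INR n); unfold cubic_ratio.
  apply Rdiv_lt_0_compat; repeat apply Rmult_lt_0_compat; lra.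
Qed.

(** The factors of the quotient regroup into steps of [third_ratio] at n, 2n and 4n, up to a
    rational function of n. *)
Lemma cubic_prod_quotient (n : nat) :
  cubic_prod 0 n / cubic_prod 1 n =
  (3 * INR n + 1) ^ 2 / ((4 * INR n + 1) * (12 * INR n + 1) * (6 * INR n + 1) ^ 2)
  * (third_ratio n ^ 2 * third_ratio (2 * n) ^ 3 * third_ratio (4 * n)).
Proof.
  induction n as [|n IH]; [unfold third_ratio; simpl; field|].
  replace (4 * S n)%nat with (S (S (S (S (4 * n))))) by lia.
  replace (2 * S n)%nat with (S (S (2 * n))) by lia.
  rewrite !third_ratio_S, !S_INR, !mult_INR.
  replace (INR 2) with 2 by (simpl; ring); replace (INR 4) with 4 by (simpl; ring).
  simpl cubic_prod.
  pose proof (pos_INR n) as Hx.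
  assert (HB := cubic_prod_pos 1 n ltac:(lra)); set (x := INR n) in *.
  set (A := cubic_prod 0 n) in *. set (B := cubic_prod 1 n) in *.
  transitivity (A / B * (cubic_ratio (0 + 3 * x) / cubic_ratio (1 + 3 * x))).
  - unfold cubic_ratio; field; repeat split; lra.
  - rewrite IH; unfold cubic_ratio; field; repeat split; lra.
Qed.

(** [cubic_prod_quotient] is cubed before the limit, so that only integer powers of n occur. The
    factor 32 comes from (2n)^3 and 4n, and 48^3 * 32 / 192^3 = 1/2. *)
Lemma cubic_hyp_quotient (g : R) : 0 < g ->
  is_lim_seq (fun n => third_ratio n ^ 3 / INR n) (g ^ 3) ->
  (48 * cubic_hyp 0 / cubic_hyp 1) ^ 3 = g ^ 18 / 2.
Proof.
  intros Hg Hx.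
  assert (H1 : 1 <= cubic_hyp 1) by (apply hyp_bounds; lra).
  assert (HP : is_lim_seq (fun n => (cubic_prod 0 n / cubic_prod 1 n) ^ 3)
    ((cubic_hyp 0 / cubic_hyp 1) ^ 3)).
  { apply is_lim_seq_pow, is_lim_seq_div'; [apply cubic_prod_lim..|]; lra. }
  assert (HQ : is_lim_seq (fun n => (cubic_prod 0 n / cubic_prod 1 n) ^ 3)
    (32 * ((3 / 6) ^ 2 * (1 / 4) * (1 / 12)) ^ 3 * ((g ^ 3) ^ 2 * (g ^ 3) ^ 3 * g ^ 3))).
  { apply is_lim_seq_ext_loc with (fun n =>
      32 * (((3 * INR n + 1) / (6 * INR n + 1)) ^ 2 * ((1 * INR n + 0) / (4 * INR n + 1))
       * ((1 * INR n + 0) / (12 * INR n + 1))) ^ 3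
      * ((third_ratio n ^ 3 / INR n) ^ 2 * (third_ratio (2 * n) ^ 3 / INR (2 * n)) ^ 3
         * (third_ratio (4 * n) ^ 3 / INR (4 * n)))).
    - exists 1%nat; intros n Hn; assert (Hn0 := lt_0_INR n Hn).
      rewrite cubic_prod_quotient, !mult_INR; replace (INR 2) with 2 by (simpl; ring);
        replace (INR 4) with 4 by (simpl; ring).
      field; repeat split; lra.
    - assert (Hx2 := is_lim_seq_dilate _ _ 2 ltac:(lia) Hx).
      assert (Hx4 := is_lim_seq_dilate _ _ 4 ltac:(lia) Hx).
      cbv beta in Hx2, Hx4.
      apply is_lim_seq_mult'; [lim_rational|].
      apply is_lim_seq_mult'; [|exact Hx4].
      apply is_lim_seq_mult'; apply is_lim_seq_pow; assumption. }
  replace (48 * cubic_hyp 0 / cubic_hyp 1) with (48 * (cubic_hyp 0 / cubic_hyp 1))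
    by (field; lra).
  rewrite Rpow_mult_distr, (is_lim_seq_inj _ _ _ HP HQ); field.
Qed.

(** * The Gamma function *)

Lemma at_right_0_pos : at_right 0 (fun a => 0 < a).
Proof. exists (mkposreal 1 Rlt_0_1); intros y _ Hy; exact Hy. Qed.

(** For a nonnegative integrand the improper integral is the supremum of the integrals over compact
    subintervals. *)
Lemma is_RInt_gen_bounded (f : R -> R) (B : R) :
  (forall x, 0 < x -> continuous f x) -> (forall x, 0 < x -> 0 <= f x) ->
  (forall a b, 0 < a < b -> RInt f a b <= B) ->
  exists l, is_RInt_gen f (at_right 0) (Rbar_locally p_infty) l /\
    forall a b, 0 < a < b -> RInt f a b <= l.
Proof.
  intros Hc Hp HB.
  assert (Hex : forall a b, 0 < a -> a <= b -> ex_RInt f a b).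
  { intros a b Ha Hab; apply (@ex_RInt_continuous R_CompleteNormedModule).
    intros x; rewrite Rmin_left, Rmax_right by lra; intros Hx; apply Hc; lra. }
  destruct (completeness (fun v => exists a b, 0 < a < b /\ v = RInt f a b)) as [l [Hub Hlub]].
  - exists B; intros v (a & b & Hab & ->); now apply HB.
  - exists (RInt f 1 2), 1, 2; split; [lra|reflexivity].
  - assert (Hle : forall a b, 0 < a < b -> RInt f a b <= l)
      by (intros a b Hab; apply Hub; now exists a, b).
    exists l; split; [|exact Hle].
    intros P [eps HP].
    assert (Hnub : ~ forall a b, 0 < a < b -> RInt f a b <= l - eps).
    { intros H; assert (l <= l - eps).
      { apply Hlub; intros v (a & b & Hab & ->); now apply H. }
      destruct eps; simpl in *; lra. }
    assert (Hex0 : exists a0 b0, 0 < a0 < b0 /\ l - eps < RInt f a0 b0).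
    { apply Classical_Prop.NNPP; intros Hn; apply Hnub; intros a b Hab.
      apply Rnot_lt_le; intros Hlt; apply Hn; now exists a, b. }
    destruct Hex0 as (a0 & b0 & Hab0 & Hgt).
    exists (fun a => 0 < a < a0) (fun b => b0 < b).
    + exists (mkposreal a0 (proj1 Hab0)); intros y Hy Hy0.
      unfold ball in Hy; simpl in Hy; unfold AbsRing_ball, minus, plus, opp in Hy; simpl in Hy.
      unfold abs in Hy; simpl in Hy; apply Rabs_lt_between in Hy; lra.
    + exists b0; easy.
    + intros a b Ha Hb; simpl.
      exists (RInt f a b); split; [apply (RInt_correct (V := R_CompleteNormedModule)), Hex; lra|].
      apply HP; unfold ball; simpl; unfold AbsRing_ball, minus, plus, opp; simpl.
      unfold abs; simpl; apply Rabs_lt_between.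
      assert (RInt f a b <= l) by (apply Hle; lra).
      assert (RInt f a b = RInt f a a0 + RInt f a0 b0 + RInt f b0 b).
      { rewrite <- (RInt_Chasles f a b0 b), <- (RInt_Chasles f a a0 b0);
          [reflexivity|apply Hex; lra..]. }
      assert (0 <= RInt f a a0)
        by (apply RInt_ge_0; [lra|apply Hex; lra|intros x Hx; apply Hp; lra]).
      assert (0 <= RInt f b0 b)
        by (apply RInt_ge_0; [lra|apply Hex; lra|intros x Hx; apply Hp; lra]).
      destruct eps; simpl in *; lra.
Qed.

Definition gamma_integrand (s t : R) : R := Rpower t (s - 1) * exp (- t).

Lemma gamma_integrand_pos (s t : R) : 0 < gamma_integrand s t.
Proof. apply Rmult_lt_0_compat; apply exp_pos. Qed.

Lemma gamma_integrand_continuous (s t : R) : 0 < t -> continuous (gamma_integrand s) t.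
Proof.
  intros Ht; apply (ex_derive_continuous (gamma_integrand s)).
  unfold gamma_integrand, Rpower; auto_derive; exact Ht.
Qed.

Lemma gamma_integrand_derive (s t : R) : 0 < t ->
  is_derive (gamma_integrand (s + 1)) t (s * gamma_integrand s t - gamma_integrand (s + 1) t).
Proof.
  intros Ht; unfold gamma_integrand, Rpower; auto_derive; [exact Ht|].
  replace ((s - 1) * ln t) with ((s + 1 - 1) * ln t + - ln t) by ring.
  rewrite exp_plus, (exp_Ropp (ln t)), exp_ln by exact Ht; field; lra.
Qed.

Lemma exp_le_compat (x y : R) : x <= y -> exp x <= exp y.
Proof. intros [H| ->]; [left; now apply exp_increasing|right; reflexivity]. Qed.

Lemma Rpower_le_exp_half (s : R) : 0 < s ->
  exists C, 0 < C /\ forall t, 0 < t -> Rpower t s <= C * exp (t / 2).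
Proof.
  (* With u = t/(2s), the inequality 1 + ln u <= u gives s ln t <= t/2 + s ln(2s). *)
  intros Hs; exists (exp (s * ln (2 * s))); split; [apply exp_pos|]; intros t Ht.
  rewrite <- exp_plus; apply exp_le_compat.
  assert (Hu : 0 < t / (2 * s)) by (apply Rdiv_lt_0_compat; lra).
  assert (H := exp_ineq1_le (ln (t / (2 * s)))).
  rewrite exp_ln, ln_div in H by lra.
  assert (H2 := Rmult_le_compat_l s _ _ (Rlt_le _ _ Hs) H).
  replace (s * (t / (2 * s))) with (t / 2) in H2 by (field; lra).
  lra.
Qed.

Lemma gamma_integrand_le (s : R) : 0 < s ->
  exists C, 0 < C /\ forall t, 0 < t -> gamma_integrand (s + 1) t <= C * exp (- t / 2).
Proof.
  intros Hs; destruct (Rpower_le_exp_half s Hs) as (C & HC & H).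
  exists C; split; [exact HC|]; intros t Ht; unfold gamma_integrand.
  replace (s + 1 - 1) with s by ring.
  replace (- t / 2) with (t / 2 + - t) by field.
  rewrite exp_plus, <- Rmult_assoc.
  apply Rmult_le_compat_r; [left; apply exp_pos|now apply H].
Qed.

Lemma ex_RInt_gamma_integrand (s a b : R) : 0 < a -> a <= b ->
  ex_RInt (gamma_integrand s) a b.
Proof.
  intros Ha Hab; apply (@ex_RInt_continuous R_CompleteNormedModule).
  intros x; rewrite Rmin_left, Rmax_right by lra; intros Hx.
  apply gamma_integrand_continuous; lra.
Qed.

(** Integration by parts avoids the singularity at 0: s times the integral equals the integral of
    t^s e^(-t), at most 2C, plus boundary terms, at most C. *)
Lemma RInt_gamma_integrand_bounded (s : R) : 0 < s ->
  exists B, forall a b, 0 < a < b -> RInt (gamma_integrand s) a b <= B.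
Proof.
  intros Hs; destruct (gamma_integrand_le s Hs) as (C & HC & H).
  exists ((C + 2 * C) / s); intros a b Hab.
  assert (Hexp : forall t, 0 < t -> 0 < exp (- t / 2) <= 1).
  { intros t Ht; split; [apply exp_pos|].
    rewrite <- exp_0; apply exp_le_compat; lra. }
  assert (I1 : RInt (gamma_integrand (s + 1)) a b <= 2 * C).
  { assert (HI : is_RInt (fun t => C * exp (- t / 2)) a b
      (- 2 * C * exp (- b / 2) - - 2 * C * exp (- a / 2))).
    { apply (is_RInt_derive (fun t => - 2 * C * exp (- t / 2))).
      - intros x _; auto_derive; [easy|unfold Rdiv; field].
      - intros x _; apply (ex_derive_continuous (fun t => C * exp (- t / 2))).
        auto_derive; easy. }
    assert (Hle : RInt (gamma_integrand (s + 1)) a b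
      <= - 2 * C * exp (- b / 2) - - 2 * C * exp (- a / 2)).
    { rewrite <- (is_RInt_unique _ _ _ _ HI); apply RInt_le; [lra| | |].
      - apply ex_RInt_gamma_integrand; lra.
      - eexists; apply HI.
      - intros x Hx; apply H; lra. }
    assert (H1 := Hexp a ltac:(lra)); assert (H2 := Hexp b ltac:(lra)); nra. }
  assert (I2 : is_RInt (fun t => s * gamma_integrand s t - gamma_integrand (s + 1) t) a b
    (gamma_integrand (s + 1) b - gamma_integrand (s + 1) a)).
  { apply (is_RInt_derive (gamma_integrand (s + 1))).
    - intros x; rewrite Rmin_left, Rmax_right by lra; intros Hx.
      apply gamma_integrand_derive; lra.
    - intros x; rewrite Rmin_left, Rmax_right by lra; intros Hx.
      apply (continuous_minus (fun t => s * gamma_integrand s t)).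
      + apply (continuous_scal_r s (gamma_integrand s)), gamma_integrand_continuous; lra.
      + apply gamma_integrand_continuous; lra. }
  assert (I3 := is_RInt_minus _ _ _ _ _ _
    (is_RInt_scal _ _ _ s _ (RInt_correct _ _ _ (ex_RInt_gamma_integrand s a b ltac:(lra) ltac:(lra))))
    (RInt_correct _ _ _ (ex_RInt_gamma_integrand (s + 1) a b ltac:(lra) ltac:(lra)))).
  apply (is_RInt_unique (V := R_CompleteNormedModule)) in I2.
  apply (is_RInt_unique (V := R_CompleteNormedModule)) in I3.
  assert (I4 : s * RInt (gamma_integrand s) a b - RInt (gamma_integrand (s + 1)) a b
    = gamma_integrand (s + 1) b - gamma_integrand (s + 1) a)
    by (rewrite <- I2; symmetry; exact I3).
  assert (Hb := H b ltac:(lra)); assert (Hb2 := Hexp b ltac:(lra)).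
  assert (Ha := gamma_integrand_pos (s + 1) a).
  apply Rle_div_r; [lra|]; nra.
Qed.

Lemma Gamma_correct (s : R) : 0 < s ->
  is_RInt_gen (gamma_integrand s) (at_right 0) (Rbar_locally p_infty) (Gamma s) /\ 0 < Gamma s.
Proof.
  intros Hs; destruct (RInt_gamma_integrand_bounded s Hs) as [B HB].
  destruct (is_RInt_gen_bounded (gamma_integrand s) B) as (l & Hl & Hle);
    [apply gamma_integrand_continuous|intros; left; apply gamma_integrand_pos|exact HB|].
  assert (Gamma s = l) as ->
    by exact (is_RInt_gen_unique (V := R_CompleteNormedModule) (gamma_integrand s) l Hl).
  split; [exact Hl|].
  apply Rlt_le_trans with (2 := Hle 1 2 ltac:(lra)).
  apply RInt_gt_0; [lra|intros; apply gamma_integrand_pos|].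
  intros x Hx; apply gamma_integrand_continuous; lra.
Qed.

Lemma Gamma_pos (s : R) : 0 < s -> 0 < Gamma s.
Proof. intros Hs; now apply Gamma_correct. Qed.

(** The derivative of t^s e^(-t) has improper integral 0 by its boundary limits, and s Gamma(s) -
    Gamma(s + 1) by linearity. *)
Lemma Gamma_S (s : R) : 0 < s -> Gamma (s + 1) = s * Gamma s.
Proof.
  intros Hs.
  destruct (Gamma_correct s Hs) as [H0 _].
  destruct (Gamma_correct (s + 1) ltac:(lra)) as [H1 _].
  assert (Hprod : forall P : R -> Prop, (forall x, 0 < x -> P x) ->
    filter_prod (at_right 0) (Rbar_locally p_infty) (fun ab => forall x,
      Rmin (fst ab) (snd ab) <= x <= Rmax (fst ab) (snd ab) -> P x)).
  { intros P HP; exists (fun a => 0 < a) (fun b => 0 < b); [apply at_right_0_pos|now exists 0|].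
    intros a b Ha Hb x; simpl; intros Hx; apply HP.
    destruct (Rle_lt_dec a b);
      [rewrite Rmin_left in Hx by lra|rewrite Rmin_right in Hx by lra]; lra. }
  assert (HD : is_RInt_gen (Derive (gamma_integrand (s + 1)))
    (at_right 0) (Rbar_locally p_infty) (0 - 0)).
  { apply is_RInt_gen_Derive.
    - apply Hprod; intros x Hx; eexists; now apply gamma_integrand_derive.
    - apply Hprod; intros x Hx.
      apply continuous_ext_loc with
        (fun t => s * gamma_integrand s t - gamma_integrand (s + 1) t).
      + exists (mkposreal x Hx); intros y Hy.
        unfold ball in Hy; simpl in Hy; unfold AbsRing_ball, minus, plus, opp in Hy; simpl in Hy.
        unfold abs in Hy; simpl in Hy; apply Rabs_lt_between in Hy.
        symmetry; apply is_derive_unique, gamma_integrand_derive; lra.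
      + apply (continuous_minus (fun t => s * gamma_integrand s t)).
        * now apply (continuous_scal_r s (gamma_integrand s)), gamma_integrand_continuous.
        * now apply gamma_integrand_continuous.
    - intros P [eps HP]; destruct eps as [e He]; simpl in HP.
      (* The radius is e^(1/s): below it y^s < e, and exp(-y) < 1. *)
      exists (mkposreal _ (exp_pos (ln e / s))); intros y Hy Hy0.
      unfold ball in Hy; simpl in Hy; unfold AbsRing_ball, minus, plus, opp in Hy; simpl in Hy.
      unfold abs in Hy; simpl in Hy; apply Rabs_lt_between in Hy.
      apply HP; unfold ball; simpl; unfold AbsRing_ball, minus, plus, opp; simpl.
      unfold abs; simpl; rewrite Ropp_0, Rplus_0_r, Rabs_pos_eq
        by (left; apply gamma_integrand_pos).
      unfold gamma_integrand, Rpower; rewrite <- exp_plus, <- (exp_ln e) by exact He.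
      apply exp_increasing.
      assert (ln y < ln e / s) by (rewrite <- (ln_exp (ln e / s)); apply ln_increasing; lra).
      assert (s * ln y < s * (ln e / s)) by (apply Rmult_lt_compat_l; lra).
      replace (s * (ln e / s)) with (ln e) in * by (field; lra); lra.
    - destruct (gamma_integrand_le s Hs) as (C & HC & H).
      intros P [eps HP]; destruct eps as [e He]; simpl in HP.
      (* Beyond this threshold the bound C exp(-y/2) drops below e. *)
      exists (Rmax 0 (- 2 * ln (e / C))); intros y Hy.
      assert (Hy0 : 0 < y) by (eapply Rle_lt_trans; [apply Rmax_l|exact Hy]).
      assert (Hy1 : - 2 * ln (e / C) < y) by (eapply Rle_lt_trans; [apply Rmax_r|exact Hy]).
      apply HP; unfold ball; simpl; unfold AbsRing_ball, minus, plus, opp; simpl.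
      unfold abs; simpl; rewrite Ropp_0, Rplus_0_r, Rabs_pos_eq
        by (left; apply gamma_integrand_pos).
      apply Rle_lt_trans with (1 := H y Hy0).
      replace e with (C * exp (ln (e / C)))
        by (rewrite exp_ln by (apply Rdiv_lt_0_compat; lra); field; lra).
      apply Rmult_lt_compat_l; [exact HC|]; apply exp_increasing; lra. }
  assert (HE : is_RInt_gen (Derive (gamma_integrand (s + 1)))
    (at_right 0) (Rbar_locally p_infty) (s * Gamma s - Gamma (s + 1))).
  { eapply is_RInt_gen_ext.
    2: apply (is_RInt_gen_minus _ _ _ _ (is_RInt_gen_scal _ s _ H0) H1).
    eapply filter_imp.
    2: apply (Hprod (fun x => minus (scal s (gamma_integrand s x)) (gamma_integrand (s + 1) x)
      = Derive (gamma_integrand (s + 1)) x)).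
    - intros ab H x Hx; apply H; lra.
    - intros x Hx; symmetry; apply is_derive_unique; now apply gamma_integrand_derive. }
  apply (is_RInt_gen_unique (V := R_CompleteNormedModule)) in HD.
  apply (is_RInt_gen_unique (V := R_CompleteNormedModule)) in HE.
  rewrite HD in HE; lra.
Qed.

Lemma Gamma_log_convex (x h : R) : 0 < x -> 0 < h ->
  Gamma (x + h) ^ 2 <= Gamma x * Gamma (x + 2 * h).
Proof.
  intros Hx Hh.
  destruct (Gamma_correct x Hx) as [H0 P0].
  destruct (Gamma_correct (x + h) ltac:(lra)) as [H1 P1].
  destruct (Gamma_correct (x + 2 * h) ltac:(lra)) as [H2 P2].
  (* AM-GM: [2 t^(x+h) <= c t^x + t^(x+2h) / c], with [c] the optimal weight *)
  set (c := Gamma (x + h) / Gamma x).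
  assert (Hc : 0 < c) by (apply Rdiv_lt_0_compat; assumption).
  assert (H : norm (2 * Gamma (x + h)) <= c * Gamma x + / c * Gamma (x + 2 * h)).
  { eapply (RInt_gen_norm (V := R_CompleteNormedModule) (Fa := at_right 0)
      (Fb := Rbar_locally p_infty)).
    3: apply (is_RInt_gen_scal _ 2 _ H1).
    3: apply (is_RInt_gen_plus _ _ _ _ (is_RInt_gen_scal _ c _ H0) (is_RInt_gen_scal _ (/ c) _ H2)).
    - exists (fun a => 0 < a < 1) (fun b => 1 < b); [|now exists 1|intros; simpl; lra].
      exists (mkposreal 1 Rlt_0_1); intros y Hy Hy0.
      unfold ball in Hy; simpl in Hy; unfold AbsRing_ball, minus, plus, opp in Hy; simpl in Hy.
      unfold abs in Hy; simpl in Hy; apply Rabs_lt_between in Hy; lra.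
    - exists (fun a => 0 < a) (fun b => 0 < b); [apply at_right_0_pos|now exists 0|].
      intros a b Ha Hb t; simpl; intros Ht.
      unfold norm, scal, plus; simpl; unfold abs, mult; simpl.
      assert (Hg := gamma_integrand_pos (x + h) t).
      rewrite Rabs_pos_eq by lra.
      assert (HAM : gamma_integrand (x + h) t ^ 2
        = gamma_integrand x t * gamma_integrand (x + 2 * h) t).
      { unfold gamma_integrand, Rpower; simpl; rewrite Rmult_1_r, <- !exp_plus; f_equal; ring. }
      assert (G0 := gamma_integrand_pos x t); assert (G2 := gamma_integrand_pos (x + 2 * h) t).
      set (u := gamma_integrand x t) in *; set (v := gamma_integrand (x + h) t) in *;
      set (w := gamma_integrand (x + 2 * h) t) in *.
      replace w with (v ^ 2 / u) by (rewrite HAM; field; lra).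
      apply Rminus_le_0.
      replace (c * u + / c * (v ^ 2 / u) - 2 * v) with ((c * u - v) ^ 2 / (c * u))
        by (field; lra).
      apply Rmult_le_pos; [apply pow2_ge_0|].
      left; apply Rinv_0_lt_compat, Rmult_lt_0_compat; assumption. }
  unfold norm in H; simpl in H; unfold abs in H; simpl in H.
  rewrite Rabs_pos_eq in H by lra.
  replace (c * Gamma x) with (Gamma (x + h)) in H by (unfold c; field; lra).
  apply Rmult_le_compat_l with (r := Gamma (x + h)) in H; [|lra].
  replace (Gamma (x + h) * (Gamma (x + h) + / c * Gamma (x + 2 * h)))
    with (Gamma (x + h) ^ 2 + Gamma x * Gamma (x + 2 * h)) in H by (unfold c; field; lra).
  lra.
Qed.

Lemma Gamma_poch (a : R) (n : nat) : 0 < a -> Gamma (a + INR n) = poch a n * Gamma a.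
Proof.
  intros Ha; induction n as [|n IH]; [simpl; rewrite Rplus_0_r; ring|].
  pose proof (pos_INR n).
  rewrite poch_S, S_INR, <- Rplus_assoc, Gamma_S, IH by lra; ring.
Qed.

(* The quotients [q y = Gamma (y + 1/3) / Gamma y] increase along steps of 1/3, and three
   consecutive ones multiply to [y]. *)
Lemma Gamma_thirds_bounds (x : R) : 1 <= x ->
  x - 1 / 3 <= (Gamma (x + 2 / 3) / Gamma (x + 1 / 3)) ^ 3 <= x + 1 / 3.
Proof.
  intros Hx.
  set (q := fun y => Gamma (y + 1 / 3) / Gamma y).
  assert (Hq : forall y, 0 < y -> 0 < q y)
    by (intros y Hy; apply Rdiv_lt_0_compat; apply Gamma_pos; lra).
  assert (Hmono : forall y, 0 < y -> q y <= q (y + 1 / 3)).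
  { intros y Hy; unfold q; assert (H := Gamma_log_convex y (1 / 3) Hy ltac:(lra)).
    replace (y + 2 * (1 / 3)) with (y + 1 / 3 + 1 / 3) in H by field.
    assert (G0 := Gamma_pos y Hy); assert (G1 := Gamma_pos (y + 1 / 3) ltac:(lra)).
    apply Rle_div_l; [exact G0|].
    replace (Gamma (y + 1 / 3 + 1 / 3) / Gamma (y + 1 / 3) * Gamma y)
      with (Gamma y * Gamma (y + 1 / 3 + 1 / 3) / Gamma (y + 1 / 3)) by (field; lra).
    apply Rle_div_r; [exact G1|]; lra. }
  assert (Hprod : forall y, 0 < y -> q y * q (y + 1 / 3) * q (y + 1 / 3 + 1 / 3) = y).
  { intros y Hy; unfold q.
    assert (G0 := Gamma_pos y Hy); assert (G1 := Gamma_pos (y + 1 / 3) ltac:(lra)).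
    assert (G2 := Gamma_pos (y + 1 / 3 + 1 / 3) ltac:(lra)).
    replace (y + 1 / 3 + 1 / 3 + 1 / 3) with (y + 1) by field.
    rewrite Gamma_S by exact Hy; field; lra. }
  replace (x + 2 / 3) with (x + 1 / 3 + 1 / 3) by field.
  change (x - 1 / 3 <= q (x + 1 / 3) ^ 3 <= x + 1 / 3).
  split.
  (* The cube of [q (x + 1/3)] is compared with the product of [q] at x - 1/3, x, x + 1/3 here, and
     at x + 1/3, x + 2/3, x + 1 for the upper bound. *)
  - assert (M1 := Hmono (x - 1 / 3) ltac:(lra)); assert (M2 := Hmono x ltac:(lra)).
    assert (HP := Hprod (x - 1 / 3) ltac:(lra)).
    replace (x - 1 / 3 + 1 / 3) with x in * by field.
    assert (Q0 := Hq (x - 1 / 3) ltac:(lra)); assert (Q1 := Hq x ltac:(lra)).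
    assert (Q2 := Hq (x + 1 / 3) ltac:(lra)).
    rewrite <- HP; simpl; rewrite Rmult_1_r, <- Rmult_assoc.
    apply Rmult_le_compat_r; [lra|]; apply Rmult_le_compat; lra.
  - assert (M1 := Hmono (x + 1 / 3) ltac:(lra)).
    assert (M2 := Hmono (x + 1 / 3 + 1 / 3) ltac:(lra)).
    assert (HP := Hprod (x + 1 / 3) ltac:(lra)).
    assert (Q2 := Hq (x + 1 / 3) ltac:(lra)).
    apply Rle_trans with (2 := Req_le _ _ HP); simpl; rewrite Rmult_1_r, Rmult_assoc.
    apply Rmult_le_compat_l; [lra|]; apply Rmult_le_compat; lra.
Qed.

(** [Gamma_poch] turns [third_ratio n] into [g] times Gamma(n + 2/3)/Gamma(n + 1/3), whose cube lies
    within 1/3 of n. *)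
Lemma third_ratio_lim :
  is_lim_seq (fun n => third_ratio n ^ 3 / INR n) ((Gamma (1 / 3) / Gamma (2 / 3)) ^ 3).
Proof.
  assert (G1 := Gamma_pos (1 / 3) ltac:(lra)); assert (G2 := Gamma_pos (2 / 3) ltac:(lra)).
  set (g := Gamma (1 / 3) / Gamma (2 / 3)).
  assert (Hg : 0 < g) by (apply Rdiv_lt_0_compat; assumption).
  replace (Finite (g ^ 3)) with (Finite (g ^ 3 * (1 / 1))) by (f_equal; field).
  apply is_lim_seq_le_le_loc with
    (fun n => g ^ 3 * ((1 * INR n + - (1 / 3)) / (1 * INR n + 0)))
    (fun n => g ^ 3 * ((1 * INR n + 1 / 3) / (1 * INR n + 0))); [|lim_rational|lim_rational].
  exists 1%nat; intros n Hn; assert (Hx := le_INR 1 n Hn); simpl in Hx.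
  assert (HB := Gamma_thirds_bounds (INR n) Hx).
  assert (HT : third_ratio n ^ 3
    = g ^ 3 * (Gamma (INR n + 2 / 3) / Gamma (INR n + 1 / 3)) ^ 3).
  { rewrite <- Rpow_mult_distr; f_equal.
    rewrite !(Rplus_comm (INR n)), !Gamma_poch by lra; unfold third_ratio, g.
    assert (0 < poch (1 / 3) n) by (apply poch_pos; lra); field; lra. }
  assert (Hg3 : 0 <= g ^ 3) by (apply pow_le; lra).
  rewrite HT; unfold Rdiv; rewrite Rmult_assoc.
  split; apply Rmult_le_compat_l; try exact Hg3;
    replace (1 * INR n + 0) with (INR n) by ring;
    apply Rmult_le_compat_r; try (left; apply Rinv_0_lt_compat); unfold Rdiv in *; lra.
Qed.

(** * The continued fraction *)

Lemma cf_pq_S (n : nat) : cf_pq (S n) = (cf_p n, cf_p (S n), cf_q n, cf_q (S n)).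
Proof.
  unfold cf_p, cf_q; simpl; destruct (cf_pq n) as [[[pm p] qm] q]; reflexivity.
Qed.

Lemma cf_p_SS (n : nat) : cf_p (S (S n)) =
  (40 * INR (S (S n)) ^ 2 + 2) * cf_p (S n) - 9 * (2 * INR (S n) + 1) ^ 4 * cf_p n.
Proof.
  unfold cf_p at 1.
  change (cf_pq (S (S n))) with (let '(pm, p, qm, q) := cf_pq (S n) in
    (p, cf_a (S (S n)) * p + cf_b (S n) * pm, q, cf_a (S (S n)) * q + cf_b (S n) * qm)).
  rewrite cf_pq_S; unfold cf_a, cf_b; ring.
Qed.

Lemma cf_q_SS (n : nat) : cf_q (S (S n)) =
  (40 * INR (S (S n)) ^ 2 + 2) * cf_q (S n) - 9 * (2 * INR (S n) + 1) ^ 4 * cf_q n.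
Proof.
  unfold cf_q at 1.
  change (cf_pq (S (S n))) with (let '(pm, p, qm, q) := cf_pq (S n) in
    (p, cf_a (S (S n)) * p + cf_b (S n) * pm, q, cf_a (S (S n)) * q + cf_b (S n) * qm)).
  rewrite cf_pq_S; unfold cf_a, cf_b; ring.
Qed.

(** As b(n) < 0 for n >= 1, positivity alone does not propagate; the growth bound does, since
    40(n+2)^2 + 2 - 9(2n+3)^2 >= (2n+5)^2. *)
Lemma cf_q_growth (n : nat) : 0 < cf_q n /\ (2 * INR n + 3) ^ 2 * cf_q n <= cf_q (S n).
Proof.
  induction n as [|n [IH1 IH2]]; [unfold cf_q; simpl; lra|].
  pose proof (pos_INR n) as Hn.
  assert (Hq : 0 < cf_q (S n)).
  { apply Rlt_le_trans with (2 := IH2), Rmult_lt_0_compat; [apply pow_lt; lra|exact IH1]. }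
  split; [exact Hq|].
  rewrite cf_q_SS, !S_INR; set (x := INR n) in *.
  assert (H : 9 * (2 * (x + 1) + 1) ^ 4 * cf_q n <= 9 * (2 * x + 3) ^ 2 * cf_q (S n)).
  { replace (9 * (2 * (x + 1) + 1) ^ 4 * cf_q n)
      with (9 * (2 * x + 3) ^ 2 * ((2 * x + 3) ^ 2 * cf_q n)) by ring.
    apply Rmult_le_compat_l; [nra|exact IH2]. }
  assert ((2 * (x + 1) + 3) ^ 2 * cf_q (S n)
    <= (40 * (x + 1 + 1) ^ 2 + 2 - 9 * (2 * x + 3) ^ 2) * cf_q (S n)); [|lra].
  apply Rmult_le_compat_r; [lra|]; nra.
Qed.

(** The square of (2n + 1)!!, the scaling that carries [minsol (S n)] to a solution of the
    recurrence of the convergents. *)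
Fixpoint odd_fact_sq (n : nat) : R :=
  match n with
  | O => 1
  | S m => odd_fact_sq m * (2 * INR (S m) + 1) ^ 2
  end.

Lemma odd_fact_sq_S (n : nat) :
  odd_fact_sq (S n) = odd_fact_sq n * (2 * INR (S n) + 1) ^ 2.
Proof. reflexivity. Qed.

Lemma odd_fact_sq_pos (n : nat) : 0 < odd_fact_sq n.
Proof.
  induction n as [|n IH]; [simpl; lra|].
  rewrite odd_fact_sq_S; apply Rmult_lt_0_compat; [exact IH|].
  pose proof (pos_INR (S n)); apply pow_lt; lra.
Qed.

(** It starts at b(0) = 324, and each step from n to n + 1 multiplies it by -b(n+1) = 9(2n+3)^4. *)
Lemma cf_casoratian (n : nat) :
  cf_p (S n) * cf_q n - cf_p n * cf_q (S n) = 324 * 9 ^ n * odd_fact_sq n ^ 2.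
Proof.
  induction n as [|n IH]; [unfold cf_p, cf_q; simpl; lra|].
  rewrite cf_p_SS, cf_q_SS, odd_fact_sq_S.
  transitivity (9 * (2 * INR (S n) + 1) ^ 4
    * (cf_p (S n) * cf_q n - cf_p n * cf_q (S n))); [ring|].
  rewrite IH, <- (tech_pow_Rmult 9 n); ring.
Qed.

(** Both sides satisfy the same second-order recurrence, so agreement at n = 0 and n = 1 suffices;
    the irregular a(1) = 33 and b(0) = 324 enter through the value at n = 1. *)
Lemma cf_remainder (n : nat) :
  36 * minsol 0 / (minsol 0 - minsol 1) * cf_q n - cf_p n
  = 36 / (minsol 0 - minsol 1) * odd_fact_sq n * minsol (S n).
Proof.
  assert (Hd : minsol 0 - minsol 1 <> 0).
  { rewrite minsol_0_minus_1; destruct (hyp_bounds (1 / 2 + 2 * 1) (1 + 1)); [lra|lra|].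
    unfold cubic_hyp; lra. }
  set (L := 36 * minsol 0 / (minsol 0 - minsol 1)).
  set (k := 36 / (minsol 0 - minsol 1)).
  cut (L * cf_q n - cf_p n = k * odd_fact_sq n * minsol (S n) /\
    L * cf_q (S n) - cf_p (S n) = k * odd_fact_sq (S n) * minsol (S (S n))); [easy|].
  induction n as [|n [IH1 IH2]].
  - assert (H := minsol_recurrence 0); simpl INR in H.
    assert (H2 : minsol 2 = (42 * minsol 1 - 9 * minsol 0) / 9) by lra.
    rewrite H2; unfold L, k, cf_p, cf_q; simpl cf_pq; simpl odd_fact_sq.
    set (M0 := minsol 0) in *; set (M1 := minsol 1) in *; clearbody M0 M1.
    split; unfold cf_a, cf_b; simpl INR; field; exact Hd.
  - split; [exact IH2|].
    assert (H := minsol_recurrence (S n)).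
    rewrite cf_p_SS, cf_q_SS.
    transitivity ((40 * INR (S (S n)) ^ 2 + 2) * (L * cf_q (S n) - cf_p (S n))
      - 9 * (2 * INR (S n) + 1) ^ 4 * (L * cf_q n - cf_p n)); [ring|].
    rewrite IH1, IH2, (odd_fact_sq_S (S n)).
    replace (2 * INR (S (S n)) + 1) with (2 * INR (S n) + 3)
      by (rewrite (S_INR (S n)); ring).
    replace (k * (odd_fact_sq (S n) * (2 * INR (S n) + 3) ^ 2) * minsol (S (S (S n))))
      with (k * odd_fact_sq (S n) * ((2 * INR (S n) + 3) ^ 2 * minsol (S (S (S n))))) by ring.
    rewrite H, odd_fact_sq_S; ring.
Qed.

(** * Asymptotics of the error *)

Lemma is_lim_seq_contraction (u d : nat -> R) : (forall n, 0 <= u n) ->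
  (forall n, u (S n) <= / 9 * u n + d n) -> is_lim_seq d 0 -> is_lim_seq u 0.
Proof.
  intros Hu Hs Hd; apply is_lim_seq_spec; intros eps.
  apply is_lim_seq_spec in Hd.
  destruct eps as [e He]; simpl.
  destruct (Hd (mkposreal (e / 4) ltac:(lra))) as [N HN]; simpl in HN.
  (* Past [N] the perturbation is below e/4, and e/2 survives the step because e/18 + e/4 <= e/2. *)
  assert (Hk : forall k, u (N + k)%nat <= (/ 9) ^ k * u N + e / 2).
  { induction k as [|k IH]; [rewrite Nat.add_0_r; simpl; lra|].
    rewrite Nat.add_succ_r; specialize (Hs (N + k)%nat).
    specialize (HN (N + k)%nat ltac:(lia)); apply Rabs_lt_between in HN.
    simpl pow; lra. }
  assert (Hg : is_lim_seq (fun k => (/ 9) ^ k * u N) 0).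
  { replace (Finite 0) with (Rbar_mult 0 (u N)) by (simpl; f_equal; ring).
    apply is_lim_seq_scal_r, is_lim_seq_geom; rewrite Rabs_pos_eq; lra. }
  apply is_lim_seq_spec in Hg.
  destruct (Hg (mkposreal (e / 2) ltac:(lra))) as [K HK]; simpl in HK.
  exists (N + K)%nat; intros n Hn.
  specialize (HK (n - N)%nat ltac:(lia)); apply Rabs_lt_between in HK.
  specialize (Hk (n - N)%nat); replace (N + (n - N))%nat with n in Hk by lia.
  specialize (Hu n); rewrite Rminus_0_r, Rabs_pos_eq by exact Hu; lra.
Qed.

(** The fixed point of v -> (v + l)/9 is l/8, so the distance of x(n)/9^n to it contracts by 1/9 up
    to an error tending to 0. *)
Lemma stolz_pow_9 (x a : nat -> R) (l : R) :
  (forall n, x (S n) - x n = 9 ^ n * a n) -> is_lim_seq a l ->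
  is_lim_seq (fun n => x n / 9 ^ n) (l / 8).
Proof.
  intros Hx Ha.
  assert (Hd : is_lim_seq (fun n => Rabs (a n - l) / 9) 0).
  { replace 0 with (0 / 9) by field.
    apply (is_lim_seq_div' (fun n => Rabs (a n - l)) (fun _ => 9));
      [|apply is_lim_seq_const|lra].
    replace 0 with (Rabs (l - l)) by (rewrite Rminus_diag; apply Rabs_R0).
    apply (is_lim_seq_abs (fun n => a n - l) (l - l)).
    apply is_lim_seq_minus'; [exact Ha|apply is_lim_seq_const]. }
  assert (Hv : is_lim_seq (fun n => Rabs (x n / 9 ^ n - l / 8)) 0).
  { apply is_lim_seq_contraction with (3 := Hd); [intros n; apply Rabs_pos|].
    intros n; assert (H9 : 0 < 9 ^ n) by (apply pow_lt; lra).
    replace (x (S n)) with (x n + 9 ^ n * a n) by (rewrite <- Hx; ring).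
    replace ((x n + 9 ^ n * a n) / 9 ^ S n - l / 8)
      with (/ 9 * (x n / 9 ^ n - l / 8) + (a n - l) / 9) by (simpl; field; lra).
    eapply Rle_trans; [apply Rabs_triang|].
    rewrite Rabs_mult, Rabs_div, (Rabs_pos_eq 9), (Rabs_pos_eq (/ 9)) by lra; lra. }
  apply is_lim_seq_abs_0 in Hv.
  apply is_lim_seq_ext with (fun n => x n / 9 ^ n - l / 8 + l / 8); [intros n; ring|].
  replace (Finite (l / 8)) with (Finite (0 + l / 8)) by (f_equal; ring).
  apply is_lim_seq_plus'; [exact Hv|apply is_lim_seq_const].
Qed.

Lemma minsol_lim (w : R) : is_lim_seq (fun n => INR n * half_sq n) w ->
  is_lim_seq (fun n => INR n * minsol n) w.
Proof.
  intros Hw.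
  apply is_lim_seq_ext with (fun n => INR n * half_sq n * hyp (1 / 2) (INR n + 1)).
  { intros n; unfold minsol; ring. }
  replace (Finite w) with (Finite (w * 1)) by (f_equal; ring).
  apply is_lim_seq_mult'; [exact Hw|].
  apply is_lim_seq_hyp_1; intros n; pose proof (pos_INR n); rewrite ?S_INR; lra.
Qed.

Theorem theorem4p1 :
  let L := Rpower 2 (- (1 / 3)) * (Gamma (1 / 3) / Gamma (2 / 3)) ^ 6 in
  is_lim_seq (fun n => cf_p n / cf_q n) L /\
  is_lim_seq (fun n => (L - cf_p n / cf_q n) / (4 * L / 3 ^ (2 * n + 2))) 1.
Proof.
  intros L.
  set (G0 := cubic_hyp 0); set (G1 := cubic_hyp 1).
  assert (HG0 : 1 <= G0) by (apply hyp_bounds; lra).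
  assert (HG1 : 1 <= G1) by (apply hyp_bounds; lra).
  destruct half_sq_third_pair_lim as (w & _ & Hw & _ & _ & Hz & _).
  assert (Hprod : G0 * G1 = 32 / 3 * w ^ 2) by now apply cubic_hyp_product.
  (* Comparing cubes keeps the powers of 2 rational. *)
  assert (HL : L = 48 * G0 / G1).
  { set (g := Gamma (1 / 3) / Gamma (2 / 3)) in L.
    assert (Hg : 0 < g) by (apply Rdiv_lt_0_compat; apply Gamma_pos; lra).
    assert (Hq := cubic_hyp_quotient g Hg third_ratio_lim); fold G0 G1 in Hq.
    assert (Hr : Rpower 2 (- (1 / 3)) ^ 3 = / 2).
    { rewrite <- Rpower_pow, Rpower_mult by apply exp_pos.
      replace (- (1 / 3) * INR 3) with (- (1)) by (simpl; field).
      rewrite Rpower_Ropp, Rpower_1 by lra; reflexivity. }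
    assert (HL3 : L ^ 3 = (48 * G0 / G1) ^ 3).
    { unfold L; rewrite Rpow_mult_distr, Hr, Hq; field. }
    assert (HLpos : 0 < L) by (apply Rmult_lt_0_compat; [apply exp_pos|now apply pow_lt]).
    assert (HRpos : 0 < 48 * G0 / G1) by (apply Rdiv_lt_0_compat; lra).
    set (l := 48 * G0 / G1) in *; clearbody l L.
    assert (HF : (L - l) * (L ^ 2 + L * l + l ^ 2) = 0)
      by (transitivity (L ^ 3 - l ^ 3); [ring|lra]).
    apply Rmult_integral in HF; destruct HF as [HF|HF]; [lra|].
    assert (0 < L * l) by now apply Rmult_lt_0_compat.
    assert (0 < L ^ 2) by now apply pow_lt.
    assert (0 < l ^ 2) by now apply pow_lt.
    lra. }
  clearbody L.
  assert (HLpos : 0 < L) by (rewrite HL; apply Rdiv_lt_0_compat; lra).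
  set (k := 48 / G1); assert (Hk : 0 < k) by (apply Rdiv_lt_0_compat; lra).
  assert (Hrem : forall n, L * cf_q n - cf_p n = k * odd_fact_sq n * minsol (S n)).
  { intros n; assert (H := cf_remainder n).
    rewrite minsol_0_minus_1, minsol_0 in H; fold G0 G1 in H.
    replace (36 * G0 / (3 / 4 * G1)) with L in H by (rewrite HL; field; lra).
    replace (36 / (3 / 4 * G1)) with k in H by (unfold k; field; lra); exact H. }
  set (e := fun n => L - cf_p n / cf_q n).
  assert (He : forall n, e n = k * odd_fact_sq n * minsol (S n) / cf_q n).
  { intros n; unfold e; rewrite <- Hrem; destruct (cf_q_growth n) as [Hqn _]; field; lra. }
  assert (Hpos : forall n, 0 < k * odd_fact_sq n * minsol (S n)).
  { intros n; apply Rmult_lt_0_compat; [|apply minsol_pos].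
    apply Rmult_lt_0_compat; [exact Hk|apply odd_fact_sq_pos]. }
  (* Over the common denominator of the two remainders L q - p, the numerator is the Casoratian,
     because L cancels. *)
  assert (Hstep : forall n, / e (S n) - / e n = 9 ^ n *
    (324 / (k ^ 2 * ((2 * INR n + 3) ^ 2 * minsol (S n) * minsol (S (S n)))))).
  { intros n; rewrite !He.
    assert (HC := cf_casoratian n).
    replace (cf_p (S n) * cf_q n - cf_p n * cf_q (S n)) with
      ((L * cf_q n - cf_p n) * cf_q (S n) - (L * cf_q (S n) - cf_p (S n)) * cf_q n)
      in HC by ring.
    rewrite !Hrem in HC.
    destruct (cf_q_growth n) as [Hq0 _]; destruct (cf_q_growth (S n)) as [Hq1 _].
    assert (HD := odd_fact_sq_pos n); assert (HM0 := minsol_pos (S n)).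
    assert (HM1 := minsol_pos (S (S n))).
    pose proof (pos_INR n).
    transitivity ((k * odd_fact_sq n * minsol (S n) * cf_q (S n)
      - k * odd_fact_sq (S n) * minsol (S (S n)) * cf_q n)
      / ((k * odd_fact_sq n * minsol (S n)) * (k * odd_fact_sq (S n) * minsol (S (S n))))).
    - assert (HD1 := odd_fact_sq_pos (S n)); field; repeat split; lra.
    - rewrite HC, odd_fact_sq_S, S_INR; field; repeat split; lra. }
  assert (HM := minsol_lim w Hz).
  assert (Hlim : is_lim_seq (fun n =>
    324 / (k ^ 2 * ((2 * INR n + 3) ^ 2 * minsol (S n) * minsol (S (S n)))))
    (324 / (k ^ 2 * ((2 / 1) * (2 / 1) * w * w)))).
  { apply is_lim_seq_ext with (fun n => 324 / (k ^ 2 *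
      (((2 * INR n + 3) / (1 * INR n + 1)) * ((2 * INR n + 3) / (1 * INR n + 2))
       * (INR (S n) * minsol (S n)) * (INR (S (S n)) * minsol (S (S n)))))).
    - intros n; rewrite !S_INR; pose proof (pos_INR n).
      assert (HM0 := minsol_pos (S n)); assert (HM1 := minsol_pos (S (S n))).
      field; repeat split; lra.
    - assert (HM1 : is_lim_seq (fun n => INR (S n) * minsol (S n)) w)
        by now apply is_lim_seq_incr_1 in HM.
      assert (HM2 : is_lim_seq (fun n => INR (S (S n)) * minsol (S (S n))) w)
        by now apply (is_lim_seq_incr_1 (fun n => INR (S n) * minsol (S n))).
      apply is_lim_seq_div'; [apply is_lim_seq_const| |].
      + apply is_lim_seq_mult'; [apply is_lim_seq_const|].
        apply is_lim_seq_mult'; [|exact HM2].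
        apply is_lim_seq_mult'; [lim_rational|exact HM1].
      + apply Rgt_not_eq, Rmult_lt_0_compat; [now apply pow_lt|].
        repeat apply Rmult_lt_0_compat; lra. }
  assert (HE := stolz_pow_9 (fun n => / e n) _ _ Hstep Hlim).
  assert (Hmain : is_lim_seq (fun n => (L - cf_p n / cf_q n) / (4 * L / 3 ^ (2 * n + 2))) 1).
  (* Since 3^(2n+2) = 9 * 9^n, the quotient is expressed through 1/e(n) divided by 9^n, whose limit
     is known. *)
  { apply is_lim_seq_ext with (fun n => 9 / (4 * L) / (/ e n / 9 ^ n)).
    - intros n; fold (e n).
      assert (0 < e n) by (rewrite He; apply Rdiv_lt_0_compat;
        [apply Hpos|apply cf_q_growth]).
      rewrite pow_add, pow_mult; replace (3 ^ 2) with 9 by ring.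
      assert (0 < 9 ^ n) by (apply pow_lt; lra); field; repeat split; lra.
    - replace (Finite 1) with (Finite (9 / (4 * L)
        / (324 / (k ^ 2 * (2 / 1 * (2 / 1) * w * w)) / 8))).
      + apply is_lim_seq_div'; [apply is_lim_seq_const|exact HE|].
        apply Rgt_not_eq; repeat apply Rdiv_lt_0_compat; try lra.
        apply Rmult_lt_0_compat; [now apply pow_lt|].
        repeat apply Rmult_lt_0_compat; lra.
      + f_equal; rewrite HL; unfold k.
        (* The product formula eliminates w: k^2 w^2 = 216 G0/G1 = 9L/2, which accounts for the
           constant 4 in the asymptotics. *)
        replace G1 with (32 / 3 * w ^ 2 / G0) by (rewrite <- Hprod; field; lra).
        field; lra. }
  split; [|exact Hmain].
  (* Convergence follows from the asymptotics: multiplying the quotient by 4L/9^(n+1), which tends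
     to 0, recovers the error. *)
  assert (He0 : is_lim_seq (fun n =>
    (L - cf_p n / cf_q n) / (4 * L / 3 ^ (2 * n + 2)) * (4 * L / 9 * (/ 9) ^ n))
    (1 * (4 * L / 9 * 0))).
  { apply is_lim_seq_mult'; [exact Hmain|].
    apply is_lim_seq_mult'; [apply is_lim_seq_const|].
    apply is_lim_seq_geom; rewrite Rabs_pos_eq; lra. }
  replace (Finite L) with (Finite (L - 1 * (4 * L / 9 * 0))) by (f_equal; field).
  eapply is_lim_seq_ext; [|apply is_lim_seq_minus'; [apply is_lim_seq_const|exact He0]].
  intros n; cbv beta; rewrite pow_add, pow_mult, pow_inv; replace (3 ^ 2) with 9 by ring.
  destruct (cf_q_growth n) as [Hqn _].
  assert (0 < 9 ^ n) by (apply pow_lt; lra); field; repeat split; lra.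
Qed.
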